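(* Let $Z_1$ be a tight multimatroid with carrier $(U_1,\Omega_1)$. Assume that each skew class $e$ of $Z_1$ is non-singular and has the form $e=\{e_1,\ldots,e_{q_e}\}$, where $q_e=|e|$. Let $\mathcal Z=\{Z_e:e\in\Omega_1\}$ be a collection of tight multimatroids indexed by the skew classes of $Z_1$ such that, for each $e$, $Z_1$ and $Z_e$ align at the non-singular skew class $e$, and such that the graph of $\mathcal Z\cup\{Z_1\}$ is a star with central vertex $Z_1$. Let $Z'$ denote the star product of $Z_1$ and $\mathcal Z$ and let $U=U(Z')$. Then \[ Q(Z';\{x_u\}_{u\in U},t)=Q\big(Z_1;\{x_{e_i}=y_{e_i}\}_{e\in\Omega_1,\,1\le i\le q_e},\,t\big),\] where for each $e\in\Omega_1$, $\{y_u\}_{u\in e}$ is the unique solution to the following system of linear equations in the ring $\mathbb Z[t,\{x_u\}_{u\in U(Z_e)-e}]$: \begin{align*} Q(Z_e|e_1;\{x_u\}_{u\in U(Z_e)-e},t)&=ty_{e_1}+y_{e_2}+\cdots+y_{e_{q_e}},\\ Q(Z_e|e_2;\{x_u\}_{u\in U(Z_e)-e},t)&=y_{e_1}+ty_{e_2}+\cdots+y_{e_{q_e}},\\ &\ \,\vdots\\ Q(Z_e|e_{q_e};\{x_u\}_{u\in U(Z_e)-e},t)&=y_{e_1}+y_{e_2}+\cdots+ty_{e_{q_e}}. \end{align*}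
   Context: A carrier is a pair $(U,\Omega)$ where $U$ is a finite set (the ground set) and $\Omega$ is a partition of $U$ into non-empty blocks called skew classes. A skew pair is a pair of distinct elements of the same skew class. A subtransversal is a subset of $U$ meeting each skew class at most once; a transversal is a subtransversal of size $|\Omega|$; a near-transversal is a subtransversal of size $|\Omega|-1$. $\mathcal S(\Omega)$ is the set of subtransversals. A multimatroid is a triple $Z=(U,\Omega,r)$ with $(U,\Omega)$ a carrier and $r:\mathcal S(\Omega)\to\mathbb Z_{\ge0}$ such that (R1) for each transversal $T$, the restriction of $r$ to subsets of $T$ is the rank function of a matroid on $T$; (R2) for each subtransversal $S$ and skew pair $\{e_i,e_j\}$ from a skew class disjoint from $S$, $r(S\cup\{e_i\})+r(S\cup\{e_j\})-2r(S)\ge 1$. $U(Z)$ denotes the ground set and $\mathcal T(Z)$ the set of transversals. The nullity of a subtransversal $S$ is $n(S)=|S|-r(S)$; $S$ is independent if $n(S)=0$; a basis is a maximal independent subtransversal. A multimatroid is determined by its carrier and its bases, via $r(S)=\max_B|B\cap S|$ over bases $B$. An element $u$ is singular if $r(\{u\})=0$; a skew class is singular if it contains a singular element. $Z$ is non-degenerate if every skew class has size at least two (then all bases are transversals). $Z$ is tight if it is non-degenerate and for every near-transversal $S$ there is a (necessarily unique) element $\theta_Z(S)$ in the skew class disjoint from $S$ with $r(S\cup\{\theta_Z(S)\})=r(S)$. Elementary minor: for $u$ in skew class $e$, $Z|u=(U-e,\Omega-\{e\},r')$ with $r'(S)=r(S\cup\{u\})-r(\{u\})$. $Z_1$ and $Z_2$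 align at a non-singular skew class $e$ if $U(Z_1)\cap U(Z_2)=e$ and $e$ is a non-singular skew class of both. If $Z_1,Z_2$ are tight multimatroids (with skew class sets $\Omega_1,\Omega_2$) aligning at a non-singular skew class $e$, the two-sum $Z_1\oplus_2 Z_2$ is the multimatroid with ground set $(U(Z_1)\cup U(Z_2))-e$, skew classes $(\Omega_1\cup\Omega_2)-\{e\}$, in which a transversal $B$ is a basis if and only if $B\cap U(Z_1)$ and $B\cap U(Z_2)$ are independent near-transversals of $Z_1$ and $Z_2$ respectively with $\theta_{Z_1}(B\cap U(Z_1))\ne\theta_{Z_2}(B\cap U(Z_2))$. The two-sum is again a tight multimatroid. A finite collection of tight multimatroids is graphable if no element belongs to the ground sets of three or more members, and any two distinct members either have disjoint ground sets or align at a non-singular skew class. The graph of a graphable collection has the members as vertices, two distinct members being adjacent if their ground sets intersect. Whenever the graph of a collection is mentioned, the collection is assumed graphable. When the graph is a tree, all the two-sums corresponding to its edges may be carried out, and the result does not depend on the order. Star product: if $Z_1$ and $\mathcal Z$ are as in the claim (graph of $\mathcal Z\cup\{Z_1\}$ a star with centre $Z_1$), their star product is the multimatroid obtained by carrying out the two-sums corresponding to all edges of this star, i.e. by successively two-summing $Z_1$ with each $Z_e$ along $e$. Weighted transition polynomial: $Q(Z;\{x_u\}_{u\in U},t)=\sum_{T\in\mathcal T(Z)}t^{n(T)}\prod_{u\in T}x_u$, where the $x_u$ and $t$ are formal variables. Writing $x_u=y_u$ inside $Q$ means that the variable $x_u$ is replaced by $y_u$. *)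

(* Defs.v *)
(* MathComp, with multinomials for the polynomial rings. *)
From HB Require Import structures.
From mathcomp Require Import all_boot all_order all_algebra.
From mathcomp Require Import mpoly.

Set Implicit Arguments.
Unset Strict Implicit.
Unset Printing Implicit Defensive.

Import GRing.Theory.

(* A triple (U, Omega, r) whose elements are taken from an ambient finite type.
   Only the values of [rank] on subtransversals are meaningful. *)
Record triple (T : finType) := Triple {
  ground : {set T};
  skews : {set {set T}};
  rank : {set T} -> nat
}.

Section Multimatroids.
Variable T : finType.
Implicit Types (Z : triple T) (S A B C e : {set T}) (u v : T).

Definition is_carrier Z : bool := partition (skews Z) (ground Z).

Definition subtransversal Z S : bool :=
  (S \subset ground Z) && [forall e in skews Z, #|S :&: e| <= 1].

Definition transversal Z S : bool :=
  subtransversal Z S && (#|S| == #|skews Z|).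

(* Stated without subtraction, so that there is no near-transversal when
   there is no skew class. *)
Definition near_transversal Z S : bool :=
  subtransversal Z S && (#|S|.+1 == #|skews Z|).

Definition matroid_rank (E : {set T}) (r : {set T} -> nat) : Prop :=
  [/\ forall A, A \subset E -> r A <= #|A|,
      forall A B, A \subset B -> B \subset E -> r A <= r B
    & forall A B, A \subset E -> B \subset E ->
        r (A :|: B) + r (A :&: B) <= r A + r B].

Definition axiom_R1 Z : Prop :=
  forall S, transversal Z S -> matroid_rank S (rank Z).

Definition axiom_R2 Z : Prop :=
  forall S e u v, subtransversal Z S ->
    e \in skews Z -> [disjoint e & S] -> u \in e -> v \in e -> u != v ->
    2 * rank Z S + 1 <= rank Z (u |: S) + rank Z (v |: S).

Definition multimatroid Z : Prop :=
  [/\ is_carrier Z, axiom_R1 Z & axiom_R2 Z].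

Definition nullity Z S : nat := #|S| - rank Z S.

Definition independent Z S : bool := nullity Z S == 0.

Definition singular Z u : bool := rank Z [set u] == 0.

Definition singular_class Z e : bool := [exists u in e, singular Z u].

Definition nondegenerate Z : Prop := forall e, e \in skews Z -> 2 <= #|e|.

Definition theta_spec Z S u : bool :=
  [exists e in skews Z, (u \in e) && [disjoint e & S]]
  && (rank Z (u |: S) == rank Z S).

Definition tight Z : Prop :=
  [/\ multimatroid Z, nondegenerate Z
    & forall S, near_transversal Z S -> exists u, theta_spec Z S u].

(* When Z is tight and S is a near-transversal this is [Some] of the only
   element satisfying [theta_spec]. *)
Definition theta Z S : option T := [pick u | theta_spec Z S u].

(* The nat subtraction is never truncated, by monotonicity of the rank. *)
Definition minor Z u : triple T :=
  let e := pblock (skews Z) u in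
  Triple (ground Z :\: e) (skews Z :\ e)
         (fun S => rank Z (u |: S) - rank Z [set u]).

Definition align Z1 Z2 e : Prop :=
  [/\ ground Z1 :&: ground Z2 = e,
      e \in skews Z1, ~~ singular_class Z1 e,
      e \in skews Z2 & ~~ singular_class Z2 e].

(* [B] is always taken among the transversals of the carrier of the two-sum,
   see [two_sum]. *)
Definition two_sum_basis Z1 Z2 B : bool :=
  let B1 := B :&: ground Z1 in
  let B2 := B :&: ground Z2 in
  [&& near_transversal Z1 B1, independent Z1 B1,
      near_transversal Z2 B2, independent Z2 B2
    & theta Z1 B1 != theta Z2 B2].

(* The two-sum along e. It is prescribed by its carrier and its bases; the
   rank is recovered from the bases by r(S) = max_B |B :&: S|. The function
   constantly 0 only serves to speak of the transversals of the carrier. *)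
Definition two_sum e Z1 Z2 : triple T :=
  let U := (ground Z1 :|: ground Z2) :\: e in
  let Omega := (skews Z1 :|: skews Z2) :\ e in
  Triple U Omega
    (fun S => \max_(B : {set T} | transversal (Triple U Omega (fun=> 0)) B
                                  && two_sum_basis Z1 Z2 B) #|B :&: S|).

Definition graphable (I : finType) (Z : I -> triple T) : Prop :=
  [/\ forall i, tight (Z i),
      forall u, #|[set i | u \in ground (Z i)]| <= 2
    & forall i j, i != j ->
        [disjoint ground (Z i) & ground (Z j)]
        \/ exists e, align (Z i) (Z j) e].

Definition collection_graph (I : finType) (Z : I -> triple T) : rel I :=
  fun i j => (i != j) && (ground (Z i) :&: ground (Z j) != set0).

Definition star_graph (I : finType) (g : rel I) (c : I) : Prop :=
  forall i j, g i j = (i != j) && ((i == c) || (j == c)).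

(* The collection {Z1} + {Ze e : e a skew class of Z1}; [None] indexes Z1.
   Values of [Ze] off the skew classes of Z1 are not used. *)
Definition star_collection Z1 (Ze : {set T} -> triple T)
    (i : option {e : {set T} | e \in skews Z1}) : triple T :=
  if i is Some e then Ze (val e) else Z1.

(* The two-sums are carried out in the order in which the skew classes of Z1
   are listed in s. *)
Definition star_product Z1 (Ze : {set T} -> triple T) (s : seq {set T}) :
    triple T :=
  foldl (fun Z e => two_sum e Z (Ze e)) Z1 s.

End Multimatroids.

Local Open Scope ring_scope.

(* Z[t, {x_u}_(u in T)], where the indeterminate indexed by [None] is t and the
   one indexed by [Some u] is x_u. *)
Notation polring T := {mpoly int[#|{: option T}|]}.

Section TransitionPolynomial.
Variable T : finType.
Implicit Types (Z : triple T) (A e : {set T}) (u v : T) (y : T -> polring T).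

Definition var_t : polring T := 'X_(enum_rank (None : option T)).
Definition var_x u : polring T := 'X_(enum_rank (Some u)).

(* The subring Z[t, {x_u}_(u in A)]. *)
Definition poly_on A (p : polring T) : Prop :=
  forall m, m \in msupp p -> forall u, u \notin A -> m (enum_rank (Some u)) = 0%N.

Definition Q Z : polring T :=
  \sum_(S : {set T} | transversal Z S)
     var_t ^+ nullity Z S * \prod_(u in S) var_x u.

(* Replaces each x_u by y u and keeps t. *)
Definition subst_x y (p : polring T) : polring T :=
  p \mPo [tuple if enum_val i is Some u then y u else var_t
         | i < #|{: option T}|].

(* The families (y_u)_(u in e) are represented by functions on T, of which only
   the values on e matter. *)
Definition is_solution Z e y : Prop :=
  (forall u, u \in e -> poly_on (ground Z :\: e) (y u)) /\
  (forall u, u \in e ->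
     Q (minor Z u) = var_t * y u + \sum_(v in e | v != u) y v).

Definition is_unique_solution Z e y : Prop :=
  is_solution Z e y /\
  (forall z : T -> polring T, is_solution Z e z ->
     forall u, u \in e -> z u = y u).

End TransitionPolynomial.

(* Main.v *)
(* Let x be the element of e spanned in Z2 by S2, when there is one. Then the
   rank of S1 :|: S2 in the two-sum is r1(x |: S1) + r2(S2) - 1, and it is
   r1(S1) + r2(S2) when S2 spans no element of e. This formula gives that the
   two-sum is tight, and for a transversal S1 :|: S2 that the nullity is
   n1(x |: S1) + n2(S2). Hence Q of the two-sum is obtained from Q(Z1) by
   replacing, for each u in e, the variable x_u by the sum y_u of
   t^n2(S2) x^S2 over the near-transversals S2 of Z2 that avoid e and have
   theta(S2) = u. Passing to the minor Z2|u raises the nullity of S2 by one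
   exactly when theta(S2) = u, so these y_u solve the linear system. *)

From mathcomp Require Import all_boot all_order all_algebra.
From mathcomp Require Import mpoly zify ring.
Require Import Defs.

Set Implicit Arguments.
Unset Strict Implicit.
Unset Printing Implicit Defensive.

Import GRing.Theory.

(** * Carriers, rank and closure *)

(** The two-sum is known only through its bases, so its rank formula needs two bounds, obtained by
    extending independent sets to independent near-transversals whose [theta] is controlled. The
    formula treats the two summands differently although the two-sum is symmetric. This is harmless
    for (R2) and for the existence of [theta]: they concern one skew class at a time, for a class of
    the first summand the trace on the second one stays fixed, and classes of the second summand
    follow by exchange. It is an obstacle for (R1), where subsets of one transversal may fall into
    different cases of the formula; there both cases are merged into a minimum. Carrying out the
    two-sums one at a time also requires that the intermediate products stay tight and aligned with
    the remaining summands, and that transition sums carry weights in an arbitrary commutative ring,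
    because the weights of an intermediate product mix indeterminates with the y_u. *)

Lemma disjoint_setD (T : finType) (A B : {set T}) : [disjoint A & B :\: A].
Proof. by have := subxx (B :\: A); rewrite subsetD disjoint_sym => /andP[]. Qed.

Section Carrier.
Variables (T : finType) (Z : triple T).
Hypothesis carZ : is_carrier Z.
Implicit Types (A B S e f : {set T}) (u v x : T).

Lemma class_uniq e f u :
  e \in skews Z -> f \in skews Z -> u \in e -> u \in f -> e = f.
Proof.
move=> he hf ue uf; have tr := partition_trivIset carZ.
by rewrite -(def_pblock tr he ue) -(def_pblock tr hf uf).
Qed.

Lemma class_disjointU1 e f x A : e \in skews Z -> f \in skews Z -> e != f ->
  x \in f -> [disjoint e & A] -> [disjoint e & x |: A].
Proof.
move=> he hf nef xf dA; rewrite disjoint_sym -setI_eq0; apply/eqP/setP => y.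
rewrite !inE; apply/negP => /andP[/orP[/eqP->|yA] ye].
  by move/eqP: nef; apply; apply: (class_uniq he hf ye).
by rewrite (disjointFr dA ye) in yA.
Qed.

Lemma class_sub e : e \in skews Z -> e \subset ground Z.
Proof. by move=> he; rewrite -(cover_partition carZ); apply: bigcup_sup. Qed.

Lemma class_exists u : u \in ground Z -> exists2 e, e \in skews Z & u \in e.
Proof.
rewrite -(cover_partition carZ) => hu.
by exists (pblock (skews Z) u); rewrite ?pblock_mem ?mem_pblock.
Qed.

Lemma class_inhabited e : e \in skews Z -> exists u, u \in e.
Proof.
move=> he; apply/set0Pn; apply: contraTneq he => ->.
by case/and3P: carZ.
Qed.

Lemma subtransversalP A :
  reflect (A \subset ground Z /\ forall e u v, e \in skews Z ->
             u \in A -> v \in A -> u \in e -> v \in e -> u = v)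
          (subtransversal Z A).
Proof.
apply: (iffP andP) => -[sA h]; split=> //.
  move=> e u v he uA vA ue ve; move/forall_inP/(_ e he)/card_le1_eqP: h => h.
  by apply/esym/h; rewrite inE ?uA ?vA.
apply/forall_inP => e he; apply/card_le1_eqP => u v.
by rewrite !inE => /andP[uA ue] /andP[vA ve]; apply: (h e).
Qed.

Lemma sub_subtransversal A B :
  A \subset B -> subtransversal Z B -> subtransversal Z A.
Proof.
move=> /subsetP sAB /subtransversalP[/subsetP sB h]; apply/subtransversalP; split.
  by apply/subsetP => x /sAB/sB.
by move=> e u v he /sAB uB /sAB vB; apply: h.
Qed.

Lemma subtransversal0 : subtransversal Z set0.
Proof. by apply/subtransversalP; split=> [|e u v _]; rewrite ?sub0set ?inE. Qed.

Lemma subtransversalU1 e u A : e \in skews Z -> u \in e -> [disjoint e & A] ->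
  subtransversal Z A -> subtransversal Z (u |: A).
Proof.
move=> he ue dA /subtransversalP[sA h]; apply/subtransversalP; split.
  by rewrite subUset sub1set sA (subsetP (class_sub he)).
move=> f v w hf /setU1P[->|vA] /setU1P[->|wA] // vf wf.
- rewrite -(class_uniq he hf ue vf) in wf.
  by have := disjointFr dA wf; rewrite wA.
- rewrite -(class_uniq he hf ue wf) in vf.
  by have := disjointFr dA vf; rewrite vA.
- exact: (h f).
Qed.

Lemma subtransversal1 u : u \in ground Z -> subtransversal Z [set u].
Proof.
move=> /class_exists[e he ue]; rewrite -[[set u]]setU0.
by apply: (subtransversalU1 he ue); rewrite ?subtransversal0 // -setI_eq0 setI0.
Qed.

(** Transversals and near-transversals are defined by their size. The set of skew classes left out
    turns these counts into membership conditions, which can be followed class by class through a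
    two-sum. *)
Definition missing A := [set e in skews Z | [disjoint e & A]].

(** Each skew class either meets A in exactly one element or is missed, so it contributes exactly
    one to the left-hand side. *)
Lemma card_missing A : subtransversal Z A -> #|A| + #|missing A| = #|skews Z|.
Proof.
move=> /andP[sA /forall_inP h].
have -> : #|A| = \sum_(e in skews Z) #|e :&: A|.
  rewrite (eq_bigr (fun e => \sum_(x in e) (x \in A : nat))); last first.
    move=> e _; rewrite -sum1_card [LHS](eq_bigl (fun x => (x \in e) && (x \in A))).
      by rewrite big_mkcondr /=; apply: eq_bigr => x _; case: (x \in A).
    by move=> x; rewrite inE.
  rewrite -(set_partition_big _ carZ).
  rewrite -sum1_card (big_setID A) /= [X in _ + X]big1 ?addn0; last first.
    by move=> x; rewrite inE => /andP[/negbTE->].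
  by rewrite (setIidPr sA); apply: eq_bigr => x ->.
have -> : #|missing A| = \sum_(e in skews Z) [disjoint e & A].
  rewrite -sum1_card [LHS](eq_bigl (fun e => (e \in skews Z) && [disjoint e & A])).
    by rewrite big_mkcondr /=; apply: eq_bigr => x _; case: [disjoint x & A].
  by move=> x; rewrite inE.
rewrite -big_split /= -sum1_card; apply: eq_bigr => e he.
have := h e he; rewrite setIC -setI_eq0 -cards_eq0.
by case: #|e :&: A| => [|[]].
Qed.

Lemma transversalE A :
  transversal Z A = subtransversal Z A && (missing A == set0).
Proof.
rewrite /transversal; case: (boolP (subtransversal Z A)) => //= hA.
by rewrite -cards_eq0 -(card_missing hA); lia.
Qed.

Lemma near_transversalE A :
  near_transversal Z A = subtransversal Z A && (#|missing A| == 1).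
Proof.
rewrite /near_transversal; case: (boolP (subtransversal Z A)) => //= hA.
by rewrite -(card_missing hA) -addn1 eqn_add2l eq_sym.
Qed.

Lemma near_transversalP e A : e \in skews Z -> [disjoint e & A] ->
  near_transversal Z A =
  subtransversal Z A && [forall f in skews Z, [disjoint f & A] ==> (f == e)].
Proof.
move=> he dA; rewrite near_transversalE; congr (_ && _).
have he' : e \in missing A by rewrite inE he.
apply/cards1P/forall_inP => [[f E] g hg|h].
  apply/implyP => dg; have : g \in missing A by rewrite inE hg.
  by move: he'; rewrite E !inE => /eqP-> .
exists e; apply/setP => g; rewrite !inE; apply/andP/eqP => [[hg dg]|->] //.
by move/implyP: (h g hg) => /(_ dg)/eqP.
Qed.

Lemma near_missing A : near_transversal Z A ->
  exists2 e, e \in skews Z & [disjoint e & A].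
Proof.
rewrite near_transversalE => /andP[_ /cards1P[e E]].
have : e \in missing A by rewrite E set11.
by rewrite inE => /andP[]; exists e.
Qed.

Lemma transversal_near e B : e \in skews Z -> transversal Z B ->
  near_transversal Z (B :\: e).
Proof.
move=> he; rewrite transversalE => /andP[sB /eqP mB].
have dB : [disjoint e & B :\: e].
  exact: disjoint_setD.
rewrite (near_transversalP he dB) (sub_subtransversal (subsetDl _ _) sB) /=.
apply/forall_inP => f hf; apply/implyP => df; apply/contraT => nfe.
suff : f \in missing B by rewrite mB inE.
rewrite inE hf -setI_eq0; apply/eqP/setP => x; rewrite !inE.
apply/negP => /andP[xf xB]; have := disjointFr df xf; rewrite inE xB andbT.
move/negbFE => xe; move/negP: nfe; apply.
by apply/eqP; apply: (class_uniq hf he xf).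
Qed.

Lemma near_transversal_add e u A : e \in skews Z -> u \in e ->
  [disjoint e & A] -> near_transversal Z A -> transversal Z (u |: A).
Proof.
move=> he ue dA; rewrite (near_transversalP he dA) transversalE.
move=> /andP[sA /forall_inP h]; rewrite (subtransversalU1 he ue) //=.
apply/eqP/setP => f; rewrite !inE; apply/negP => /andP[hf df].
have dfA : [disjoint f & A] by apply: disjointWr df; apply: subsetUr.
move: (h f hf); rewrite dfA /= => /eqP E.
by have := disjointFr df (_ : u \in f); rewrite E ue setU11 => /(_ isT).
Qed.

Lemma transversal_meets e B : e \in skews Z -> transversal Z B ->
  exists u, [/\ u \in e, u \in B & B :\: e = B :\ u].
Proof.
move=> he; rewrite transversalE => /andP[/subtransversalP[_ h] /eqP mB].
have : e \notin missing B by rewrite mB inE.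
rewrite inE he /= -setI_eq0 => /set0Pn[u]; rewrite inE => /andP[ue uB].
exists u; split=> //; apply/setP => x; rewrite !inE.
case xB: (x \in B); rewrite ?andbF // !andbT; congr negb.
apply/idP/eqP => [xe|-> //]; exact: (h e).
Qed.

End Carrier.

(** * Rank, spanning and independence on subtransversals *)

Section Rank.
Variables (T : finType) (Z : triple T).
Hypothesis mmZ : multimatroid Z.
Implicit Types (A B C S e f : {set T}) (u v x : T).

Let carZ : is_carrier Z. Proof. by case: mmZ. Qed.

(** (R1) speaks of transversals only; the rank inequalities for subtransversals are inherited
    through this extension. *)
Lemma subtransversal_extend A : subtransversal Z A ->
  exists2 B, transversal Z B & A \subset B.
Proof.
move=> hA; have [B /maxsetP[sB mB] sAB] := maxset_exists (P := subtransversal Z) hA.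
exists B => //; rewrite transversalE // sB /=.
apply/eqP/setP => e; rewrite !inE; apply/negP => /andP[he dB].
have [u ue] := class_inhabited carZ he.
have E := mB _ (subtransversalU1 carZ he ue dB sB) (subsetUr _ _).
by have := disjointFr dB ue; rewrite -E setU11.
Qed.

Lemma rank_le_card A : subtransversal Z A -> rank Z A <= #|A|.
Proof.
case: mmZ => _ h _ /subtransversal_extend[B tB sAB].
by have [h1 _ _] := h B tB; apply: h1.
Qed.

Lemma rank_mono A B : A \subset B -> subtransversal Z B -> rank Z A <= rank Z B.
Proof.
case: mmZ => _ h _ sAB /subtransversal_extend[C tC sBC].
by have [_ h2 _] := h C tC; apply: h2.
Qed.

Lemma rankU1_eq u A : subtransversal Z (u |: A) ->
  rank Z (u |: A) <= rank Z A -> rank Z (u |: A) = rank Z A.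
Proof. by move=> sA h; apply/eqP; rewrite eqn_leq h rank_mono // subsetUr. Qed.

Lemma rank_submod A B : subtransversal Z (A :|: B) ->
  rank Z (A :|: B) + rank Z (A :&: B) <= rank Z A + rank Z B.
Proof.
case: mmZ => _ h _ /subtransversal_extend[C tC]; rewrite subUset => /andP[sA sB].
by have [_ _ h3] := h C tC; apply: h3.
Qed.

Lemma rankU1_le u A : subtransversal Z (u |: A) -> rank Z (u |: A) <= (rank Z A).+1.
Proof.
move=> sA; have := rank_submod sA.
have := rank_le_card (sub_subtransversal (subsetUl [set u] A) sA).
by rewrite cards1; lia.
Qed.

(** Submodularity for [u |: A] and B, whose union is [u |: B] and whose intersection contains A:
    what A spans, B spans too. *)
Lemma rank_closed_mono A B u : A \subset B -> subtransversal Z (u |: B) ->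
  rank Z (u |: A) = rank Z A -> rank Z (u |: B) = rank Z B.
Proof.
move=> sAB sB E.
have EU : (u |: A) :|: B = u |: B by rewrite -setUA (setUidPr sAB).
have := @rank_submod (u |: A) B; rewrite EU => /(_ sB).
have sB' := sub_subtransversal (subsetUr _ _) sB.
have := @rank_mono A ((u |: A) :&: B); rewrite subsetI subsetUr sAB => /(_ isT).
move/(_ (sub_subtransversal (subsetIr _ _) sB')).
by have := rank_mono (subsetUr [set u] B) sB; lia.
Qed.

Lemma rank_spanned A S : A \subset S -> subtransversal Z S ->
  (forall v, v \in S -> rank Z (v |: A) = rank Z A) -> rank Z S = rank Z A.
Proof.
move=> sAS stS h; pose P C := (C \subset S) && (rank Z C == rank Z A).
have PA : P A by rewrite /P sAS eqxx.
have [C /maxsetP[/andP[sCS /eqP rC] mC] sAC] := maxset_exists PA.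
suff <- : C = S by [].
apply/eqP; rewrite eqEsubset sCS; apply/subsetP => v vS.
have sv : v |: C \subset S by rewrite subUset sub1set vS.
suff /mC <- : P (v |: C); rewrite ?setU11 ?subsetUr // /P sv -rC.
apply/eqP; apply: (rank_closed_mono sAC); last exact: h.
exact: sub_subtransversal sv stS.
Qed.

(** A maximal independent set between A and S spans S, since an element raising its rank would
    enlarge it. Starting from a given A makes it possible to choose a basis through a prescribed
    element. *)
Lemma basis_between A S : A \subset S -> subtransversal Z S -> rank Z A = #|A| ->
  exists C, [/\ A \subset C, C \subset S, rank Z C = #|C| & rank Z S = rank Z C].
Proof.
move=> sAS stS rA; pose P C := (C \subset S) && (rank Z C == #|C|).
have PA : P A by rewrite /P sAS rA eqxx.
have [C /maxsetP[/andP[sCS /eqP rC] mC] sAC] := maxset_exists PA.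
exists C; split=> //; apply: rank_spanned => // v vS.
have sv : v |: C \subset S by rewrite subUset sub1set vS.
have stv := sub_subtransversal sv stS.
have [vC|nvC] := boolP (v \in C); first by rewrite (setUidPr _) // sub1set.
have := rankU1_le stv; rewrite leq_eqVlt => /orP[/eqP E|]; last first.
  by rewrite ltnS => h; apply/eqP; rewrite eqn_leq h rank_mono // subsetUr.
have := mC (v |: C); rewrite /P sv E rC cardsU1 nvC add1n eqxx subsetUr.
by move=> /(_ isT isT) EC; move: nvC; rewrite -EC setU11.
Qed.

Lemma basis_exists S : subtransversal Z S ->
  exists C, [/\ C \subset S, rank Z C = #|C| & rank Z S = rank Z C].
Proof.
move=> stS; have r0 : rank Z set0 = #|(set0 : {set T})|.
  by apply/eqP; rewrite eqn_leq rank_le_card ?subtransversal0 // cards0.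
have [C [_ h1 h2 h3]] := basis_between (sub0set S) stS r0.
by exists C.
Qed.

Lemma indep_sub A B : A \subset B -> subtransversal Z B -> rank Z B = #|B| ->
  rank Z A = #|A|.
Proof.
move=> sAB sB rB.
have E : A :|: (B :\: A) = B by rewrite setDE setUIr setUCr setIT; apply/setUidPr.
have := @rank_submod A (B :\: A); rewrite E => /(_ sB).
have := rank_le_card (sub_subtransversal (subsetDl B A) sB).
have := rank_le_card (sub_subtransversal sAB sB).
by have := cardsID A B; rewrite (setIidPr sAB); lia.
Qed.

(** If a maximal independent B missed a class, no element of the class could raise its rank; but the
    class has two elements, and by (R2) one of them does. *)
Lemma indep_extend C : nondegenerate Z -> subtransversal Z C -> rank Z C = #|C| ->
  exists B, [/\ transversal Z B, C \subset B & rank Z B = #|B|].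
Proof.
move=> nd sC rC; pose P B := subtransversal Z B && (rank Z B == #|B|).
have PC : P C by rewrite /P sC rC eqxx.
have [B /maxsetP[/andP[sB /eqP rB] mB] sCB] := maxset_exists PC.
exists B; split=> //; rewrite transversalE // sB.
apply/eqP/setP => e; rewrite !inE; apply/negP => /andP[he dB].
have key w : w \in e -> rank Z (w |: B) <= rank Z B.
  move=> we; have sw := subtransversalU1 carZ he we dB sB.
  rewrite leqNgt; apply/negP => lt.
  have nwB : w \notin B by rewrite (disjointFr dB we).
  have /mB E : P (w |: B).
    by rewrite /P sw cardsU1 nwB add1n -rB eqn_leq rankU1_le.
  by move: nwB; rewrite -(E (subsetUr _ _)) setU11.
have /card_gt1P[u [v [ue ve uv]]] := nd e he.
case: mmZ => _ _ /(_ B e u v sB he dB ue ve uv).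
by have := key _ ue; have := key _ ve; lia.
Qed.

Lemma independentE A : subtransversal Z A -> independent Z A = (rank Z A == #|A|).
Proof. by move=> /rank_le_card; rewrite /independent /nullity; lia. Qed.

Lemma closed_uniq e u v A : e \in skews Z -> [disjoint e & A] ->
  subtransversal Z A -> u \in e -> v \in e ->
  rank Z (u |: A) = rank Z A -> rank Z (v |: A) = rank Z A -> u = v.
Proof.
case: mmZ => _ _ h he dA sA ue ve ru rv; apply/eqP/negPn/negP => uv.
by have := h A e u v sA he dA ue ve uv; rewrite ru rv; lia.
Qed.

Lemma nonsingular_rank e u : e \in skews Z -> ~~ singular_class Z e -> u \in e ->
  rank Z [set u] = 1.
Proof.
move=> he ns ue; have su := subtransversal1 carZ (subsetP (class_sub carZ he) u ue).
have := rank_le_card su; rewrite cards1.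
have : rank Z [set u] != 0.
  by move: ns; rewrite negb_exists => /forallP/(_ u); rewrite ue.
by case: (rank Z [set u]) => [|[]].
Qed.

Lemma theta_eq e u A : e \in skews Z -> [disjoint e & A] -> near_transversal Z A ->
  u \in e -> rank Z (u |: A) = rank Z A -> theta Z A = Some u.
Proof.
move=> he dA nA ue ru; rewrite /theta; case: pickP => [v|/(_ u)]; last first.
  by rewrite /theta_spec ru eqxx andbT => /existsP[]; exists e; rewrite he ue.
case/andP=> /exists_inP[f hf /andP[vf dfA] /eqP rv].
have sA : subtransversal Z A by case/andP: nA.
move: nA; rewrite (near_transversalP carZ he dA) => /andP[_ /forall_inP/(_ f hf)].
rewrite dfA /= => /eqP E; rewrite E in vf.
by rewrite (closed_uniq he dA sA ue vf ru rv).
Qed.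

End Rank.

(** * Near-transversals of tight multimatroids *)

Section Tight.
Variables (T : finType) (Z : triple T).
Hypothesis tZ : tight Z.
Implicit Types (A B C S e f : {set T}) (u v x : T).

Let mmZ : multimatroid Z. Proof. by case: tZ. Qed.
Let carZ : is_carrier Z. Proof. by case: mmZ. Qed.

Lemma theta_exists e A : e \in skews Z -> [disjoint e & A] -> near_transversal Z A ->
  exists u, [/\ u \in e, theta Z A = Some u & rank Z (u |: A) = rank Z A].
Proof.
move=> he dA nA; case: tZ => _ _ /(_ A nA)[u].
case/andP=> /exists_inP[f hf /andP[uf dfA] /eqP ru].
have E : f = e.
  move: nA; rewrite (near_transversalP carZ he dA) => /andP[_ /forall_inP/(_ f hf)].
  by rewrite dfA /= => /eqP.
rewrite E in uf; exists u; split=> //; exact: (theta_eq mmZ he).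
Qed.

Lemma theta_closed e u A : e \in skews Z -> [disjoint e & A] ->
  near_transversal Z A -> u \in e ->
  (theta Z A == Some u) = (rank Z (u |: A) == rank Z A).
Proof.
move=> he dA nA ue; apply/eqP/eqP => [|ru]; last exact: (theta_eq mmZ he).
by have [v [_ -> rv]] := theta_exists he dA nA; case=> <-.
Qed.

Lemma indep_near_extend e C : e \in skews Z -> subtransversal Z C ->
  [disjoint e & C] -> rank Z C = #|C| ->
  exists B, [/\ near_transversal Z B, [disjoint e & B], C \subset B &
                rank Z B = #|B|].
Proof.
move=> he sC dC rC; have [_ nd _] := tZ.
have [B [tB sCB rB]] := indep_extend mmZ nd sC rC.
have sB : subtransversal Z B by case/andP: tB.
exists (B :\: e); split.
- exact: transversal_near.
- exact: disjoint_setD.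
- by rewrite subsetD sCB disjoint_sym.
- exact: (indep_sub mmZ (subsetDl _ _) sB).
Qed.

(** The set [x |: C] extends to an independent transversal, and x is its element in e. Removing x
    leaves a near-transversal that does not span x. *)
Lemma indep_near_extend_avoiding e x C : e \in skews Z -> x \in e ->
  subtransversal Z C -> [disjoint e & C] -> rank Z (x |: C) = #|C|.+1 ->
  exists B, [/\ near_transversal Z B, [disjoint e & B], C \subset B,
                rank Z B = #|B| & theta Z B != Some x].
Proof.
move=> he xe sC dC rC; have [_ nd _] := tZ.
have nxC : x \notin C by rewrite (disjointFr dC xe).
have rxC : rank Z (x |: C) = #|x |: C| by rewrite cardsU1 nxC.
have [B [tB sCB rB]] :=
  indep_extend mmZ nd (subtransversalU1 carZ he xe dC sC) rxC.
have sB : subtransversal Z B by case/andP: tB.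
have xB : x \in B by rewrite (subsetP sCB) // setU11.
have dB : [disjoint e & B :\: e].
  exact: disjoint_setD.
have EB : B :\: e = B :\ x.
  have [u [ue uB ->]] := transversal_meets carZ he tB.
  suff -> : u = x by [].
  by case/(subtransversalP Z B): sB => _; apply; eauto.
have nB : near_transversal Z (B :\: e) by apply: transversal_near.
exists (B :\: e); split=> //.
- by rewrite subsetD disjoint_sym dC (subset_trans _ sCB) // subsetUr.
- exact: (indep_sub mmZ (subsetDl _ _) sB).
rewrite (theta_closed he dB nB xe) EB setD1K // rB (cardsD1 x) xB.
by rewrite (indep_sub mmZ (subsetDl _ _) sB) // neq_ltn leqnn orbT.
Qed.

End Tight.

(** * The rank of a two-sum *)

Section TwoSumRank.
Variables (T : finType) (Z1 Z2 : triple T) (e : {set T}).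
Hypotheses (tZ1 : tight Z1) (tZ2 : tight Z2) (al : align Z1 Z2 e).
Implicit Types (A B C S f : {set T}) (u v x : T).

Local Notation W := (two_sum e Z1 Z2).
Local Notation U1 := (ground Z1).
Local Notation U2 := (ground Z2).

Let mm1 : multimatroid Z1. Proof. by case: tZ1. Qed.
Let mm2 : multimatroid Z2. Proof. by case: tZ2. Qed.
Let car1 : is_carrier Z1. Proof. by case: mm1. Qed.
Let car2 : is_carrier Z2. Proof. by case: mm2. Qed.
Let he1 : e \in skews Z1. Proof. by case: al. Qed.
Let he2 : e \in skews Z2. Proof. by case: al. Qed.

Lemma align_mem x : (x \in e) = (x \in U1) && (x \in U2).
Proof. by case: al => <- _ _ _ _; rewrite inE. Qed.

Lemma class1_disjoint f : f \in skews Z1 -> f != e -> [disjoint f & U2].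
Proof.
move=> hf; apply: contraNT; rewrite -setI_eq0 => /set0Pn[x].
rewrite inE => /andP[xf x2]; apply/eqP; apply: (class_uniq car1 hf he1 xf).
by rewrite align_mem x2 (subsetP (class_sub car1 hf)).
Qed.

Lemma class2_disjoint f : f \in skews Z2 -> f != e -> [disjoint f & U1].
Proof.
move=> hf; apply: contraNT; rewrite -setI_eq0 => /set0Pn[x].
rewrite inE => /andP[xf x2]; apply/eqP; apply: (class_uniq car2 hf he2 xf).
by rewrite align_mem x2 (subsetP (class_sub car2 hf)).
Qed.

Lemma two_sum_carrier : is_carrier W.
Proof.
apply/and3P; split=> /=.
- apply/eqP/setP => x; apply/bigcupP/idP.
    case=> f; rewrite !inE => /andP[nfe /orP[hf|hf]] xf.
      rewrite (subsetP (class_sub car1 hf)) //= andbT align_mem.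
      by rewrite (disjointFr (class1_disjoint hf nfe) xf) andbF.
    rewrite (subsetP (class_sub car2 hf)) // orbT andbT align_mem.
    by rewrite (disjointFr (class2_disjoint hf nfe) xf).
  rewrite !inE => /andP[nxe /orP[]] hx.
    have [f hf xf] := class_exists car1 hx; exists f => //.
    by rewrite !inE hf andbT; apply: contraNneq nxe => <-.
  have [f hf xf] := class_exists car2 hx; exists f => //.
  by rewrite !inE hf orbT andbT; apply: contraNneq nxe => <-.
- apply/trivIsetP => f g; rewrite !inE => /andP[nf hf] /andP[ng hg] nfg.
  rewrite -setI_eq0; apply/eqP/setP => x; rewrite !inE; apply/negP => /andP[xf xg].
  case/orP: hf => hf; case/orP: hg => hg.
  + by move/negP: nfg; apply; apply/eqP; apply: (class_uniq car1 hf hg xf).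
  + have := disjointFr (class1_disjoint hf nf) xf.
    by rewrite (subsetP (class_sub car2 hg)).
  + have := disjointFr (class2_disjoint hf nf) xf.
    by rewrite (subsetP (class_sub car1 hg)).
  + by move/negP: nfg; apply; apply/eqP; apply: (class_uniq car2 hf hg xf).
rewrite !inE negb_and; apply/orP; right.
rewrite negb_or; apply/andP; split.
  by case/and3P: car1.
by case/and3P: car2.
Qed.

Lemma subtransversal_two_sum A : subtransversal W A =
  [&& A \subset (U1 :|: U2) :\: e, subtransversal Z1 (A :&: U1)
    & subtransversal Z2 (A :&: U2)].
Proof.
apply/(subtransversalP W A)/and3P => [[sA h]|[sA h1 h2]].
  split=> //; apply/subtransversalP; split; rewrite ?subsetIr // => f u v hf.
    rewrite !inE => /andP[uA u1] /andP[vA v1] uf vf.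
    apply: (h f) => //; rewrite !inE hf andbT; apply: contraTneq uA => E.
    by apply/negP => /(subsetP sA); rewrite inE -E uf.
  rewrite !inE => /andP[uA u1] /andP[vA v1] uf vf.
  apply: (h f) => //; rewrite !inE hf orbT andbT; apply: contraTneq uA => E.
  by apply/negP => /(subsetP sA); rewrite inE -E uf.
split=> // f u v; rewrite !inE => /andP[nf /orP[hf|hf]] uA vA uf vf.
  case/subtransversalP: h1 => _ h; apply: (h f); rewrite ?inE ?uA ?vA //=.
    exact: (subsetP (class_sub car1 hf)).
  exact: (subsetP (class_sub car1 hf)).
case/subtransversalP: h2 => _ h; apply: (h f); rewrite ?inE ?uA ?vA //=.
  exact: (subsetP (class_sub car2 hf)).
exact: (subsetP (class_sub car2 hf)).
Qed.

Lemma two_sum_sub1 A : subtransversal W A -> subtransversal Z1 (A :&: U1).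
Proof. by rewrite subtransversal_two_sum => /and3P[]. Qed.

Lemma two_sum_sub2 A : subtransversal W A -> subtransversal Z2 (A :&: U2).
Proof. by rewrite subtransversal_two_sum => /and3P[]. Qed.

Lemma two_sum_disjoint A V : subtransversal W A -> [disjoint e & A :&: V].
Proof.
move=> /andP[/subsetP sA _]; rewrite -setI_eq0; apply/eqP/setP => x; rewrite !inE.
apply/negP => /andP[xe /andP[xA _]].
by move: (sA x xA); rewrite inE xe.
Qed.

Lemma missing_two_sum A :
  missing W A = (missing Z1 (A :&: U1) :|: missing Z2 (A :&: U2)) :\ e.
Proof.
have D (f V : {set T}) : f \subset V -> [disjoint f & A :&: V] = [disjoint f & A].
  by move=> /setIidPl fV; rewrite -!setI_eq0 setICA setIC fV setIC.
apply/setP => f; rewrite !inE -andbA; congr (_ && _).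
case h1: (f \in skews Z1); case h2: (f \in skews Z2) => //=.
- by rewrite !D ?orbb // class_sub.
- by rewrite D ?orbF // class_sub.
- by rewrite D // class_sub.
Qed.

Lemma two_sum_near1 B : transversal W B -> near_transversal Z1 (B :&: U1).
Proof.
rewrite (transversalE two_sum_carrier) => /andP[sB /eqP mB].
rewrite (near_transversalP car1 he1 (two_sum_disjoint _ sB)) two_sum_sub1 //=.
apply/forall_inP => f hf; apply/implyP => df; apply/contraT => nf.
have : f \in missing W B by rewrite missing_two_sum !inE nf hf df.
by rewrite mB inE.
Qed.

Lemma two_sum_near2 B : transversal W B -> near_transversal Z2 (B :&: U2).
Proof.
rewrite (transversalE two_sum_carrier) => /andP[sB /eqP mB].
rewrite (near_transversalP car2 he2 (two_sum_disjoint _ sB)) two_sum_sub2 //=.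
apply/forall_inP => f hf; apply/implyP => df; apply/contraT => nf.
have : f \in missing W B by rewrite missing_two_sum !inE nf hf df orbT.
by rewrite mB inE.
Qed.

Lemma union_trace1 B1 B2 : B1 \subset U1 -> B2 \subset U2 -> [disjoint e & B2] ->
  (B1 :|: B2) :&: U1 = B1.
Proof.
move=> /subsetP s1 /subsetP s2 d2; apply/setP => x; rewrite !inE.
case x1: (x \in B1) => /=; first by rewrite s1.
apply/negP => /andP[x2 xU]; have := disjointFl d2 x2.
by rewrite align_mem xU s2.
Qed.

Lemma union_trace2 B1 B2 : B1 \subset U1 -> B2 \subset U2 -> [disjoint e & B1] ->
  (B1 :|: B2) :&: U2 = B2.
Proof.
move=> /subsetP s1 /subsetP s2 d1; apply/setP => x; rewrite !inE.
case x1: (x \in B2) => /=; first by rewrite orbT s2.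
rewrite orbF; apply/negP => /andP[x2 xU]; have := disjointFl d1 x2.
by rewrite align_mem xU s1.
Qed.

Lemma union_transversal B1 B2 :
  near_transversal Z1 B1 -> [disjoint e & B1] ->
  near_transversal Z2 B2 -> [disjoint e & B2] -> transversal W (B1 :|: B2).
Proof.
move=> n1 d1 n2 d2.
have s1 : subtransversal Z1 B1 by case/andP: n1.
have s2 : subtransversal Z2 B2 by case/andP: n2.
have /andP[g1 _] := s1; have /andP[g2 _] := s2.
rewrite (transversalE two_sum_carrier) subtransversal_two_sum missing_two_sum.
rewrite union_trace1 // union_trace2 // s1 s2 /= !andbT; apply/andP; split.
  apply/subsetP => x; rewrite !inE => /orP[] h.
    by rewrite (disjointFl d1 h) (subsetP g1).
  by rewrite (disjointFl d2 h) (subsetP g2) // orbT.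
move: n1 n2; rewrite (near_transversalP car1 he1 d1) (near_transversalP car2 he2 d2).
move=> /andP[_ /forall_inP h1] /andP[_ /forall_inP h2].
apply/eqP/setP => f; rewrite !inE; apply/negP => /andP[nf].
case/orP=> /andP[hf df]; [have := h1 f hf | have := h2 f hf];
  by rewrite df (negbTE nf).
Qed.

Lemma two_sum_card A B : A \subset (U1 :|: U2) :\: e ->
  #|B :&: A| = #|(B :&: U1) :&: (A :&: U1)| + #|(B :&: U2) :&: (A :&: U2)|.
Proof.
move=> /subsetP sA; rewrite -(cardsID U1 (B :&: A)); congr (_ + _); apply: eq_card => x.
  by rewrite !inE; case: (x \in B); case: (x \in A); case: (x \in U1).
rewrite !inE; case: (x \in B); rewrite ?andbF //=.
have := sA x; case: (x \in A); rewrite ?andbF //= => /(_ isT).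
by rewrite !inE align_mem; case: (x \in U1); case: (x \in U2).
Qed.

(** With the upper bound that follows, this trades the maximum over bases for pairs of independent
    near-transversals with different [theta], one in each summand. *)
Lemma rank_two_sum_ge A B1 B2 : A \subset (U1 :|: U2) :\: e ->
  near_transversal Z1 B1 -> [disjoint e & B1] -> rank Z1 B1 = #|B1| ->
  near_transversal Z2 B2 -> [disjoint e & B2] -> rank Z2 B2 = #|B2| ->
  theta Z1 B1 != theta Z2 B2 ->
  #|B1 :&: (A :&: U1)| + #|B2 :&: (A :&: U2)| <= rank W A.
Proof.
move=> sA n1 d1 r1 n2 d2 r2 th.
have s1 : subtransversal Z1 B1 by case/andP: n1.
have s2 : subtransversal Z2 B2 by case/andP: n2.
have /andP[g1 _] := s1; have /andP[g2 _] := s2.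
have E1 : (B1 :|: B2) :&: U1 = B1 by apply: union_trace1.
have E2 : (B1 :|: B2) :&: U2 = B2 by apply: union_trace2.
have := two_sum_card (B1 :|: B2) sA; rewrite E1 E2 => <- /=.
apply: (leq_bigmax_cond (F := fun B => #|B :&: A|)).
apply/andP; split; first exact: union_transversal.
rewrite /two_sum_basis E1 E2 n1 n2 th !independentE // ?r1 ?r2 ?eqxx //.
Qed.

Lemma rank_two_sum_le A n : A \subset (U1 :|: U2) :\: e ->
  (forall B1 B2,
     near_transversal Z1 B1 -> [disjoint e & B1] -> rank Z1 B1 = #|B1| ->
     near_transversal Z2 B2 -> [disjoint e & B2] -> rank Z2 B2 = #|B2| ->
     theta Z1 B1 != theta Z2 B2 ->
     #|B1 :&: (A :&: U1)| + #|B2 :&: (A :&: U2)| <= n) ->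
  rank W A <= n.
Proof.
move=> sA h; apply/bigmax_leqP => B /andP[tB /and5P[n1 i1 n2 i2 th]].
have sB : subtransversal W B by case/andP: tB.
rewrite two_sum_card //; apply: h => //; rewrite ?two_sum_disjoint //.
  by apply/eqP; rewrite -independentE // two_sum_sub1.
by apply/eqP; rewrite -independentE // two_sum_sub2.
Qed.

Lemma rank_trace_le Z B A : multimatroid Z -> subtransversal Z B ->
  rank Z B = #|B| -> subtransversal Z A -> #|B :&: A| <= rank Z A.
Proof.
move=> mmZ sB rB sA; rewrite -(indep_sub mmZ (subsetIl B A)) //.
by apply: rank_mono; rewrite ?subsetIr.
Qed.

(** The successor stands for the missing unit without a subtraction. That unit comes from the
    condition on [theta]: if B2 contains a basis of the trace of A, its [theta] is x, so B1 must not
    span x, and then the independent set [x |: B1] spends one unit of the rank of [x |: (A :&: U1)]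
    on x. *)
Lemma rank_two_sum_closed A x : subtransversal W A -> x \in e ->
  rank Z2 (x |: (A :&: U2)) = rank Z2 (A :&: U2) ->
  (rank W A).+1 = rank Z1 (x |: (A :&: U1)) + rank Z2 (A :&: U2).
Proof.
move=> sW xe cx; have sA : A \subset (U1 :|: U2) :\: e by case/andP: sW.
have sA1 := two_sum_sub1 sW; have sA2 := two_sum_sub2 sW.
have d1 := two_sum_disjoint U1 sW; have d2 := two_sum_disjoint U2 sW.
have sx1 := subtransversalU1 car1 he1 xe d1 sA1.
have sx2 := subtransversalU1 car2 he2 xe d2 sA2.
have ns1 : ~~ singular_class Z1 e by case: al.
apply/eqP; rewrite eqn_leq; apply/andP; split.
  have pos : 0 < rank Z1 (x |: A :&: U1).
    have := rank_mono mm1 (subsetUl [set x] (A :&: U1)) sx1.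
    by rewrite (nonsingular_rank mm1 he1 ns1 xe).
  rewrite -(prednK pos) addSn ltnS; apply: rank_two_sum_le => // B1 B2.
  move=> n1 dB1 r1 n2 dB2 r2 th.
  have sB1 : subtransversal Z1 B1 by case/andP: n1.
  have sB2 : subtransversal Z2 B2 by case/andP: n2.
  have l1 := rank_trace_le mm1 sB1 r1 sA1.
  have l2 := rank_trace_le mm2 sB2 r2 sA2.
  have l1x := rank_mono mm1 (subsetUr [set x] (A :&: U1)) sx1.
  (* If B2 does not contain a basis of the trace of A, the unit is already lost in the second
     summand. *)
  have [E|] := eqVneq #|B2 :&: (A :&: U2)| (rank Z2 (A :&: U2)); last first.
    by move: l1 l2 l1x; clear; lia.
  have sI := sub_subtransversal (setUS [set x] (subsetIr B2 (A :&: U2))) sx2.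
  have rI := indep_sub mm2 (subsetIl B2 (A :&: U2)) sB2 r2.
  have cI : rank Z2 (x |: (B2 :&: (A :&: U2))) = rank Z2 (B2 :&: (A :&: U2)).
    apply: (rankU1_eq mm2 sI); rewrite rI E -cx.
    by apply: rank_mono; rewrite ?setUS ?subsetIr.
  have sxB2 := subtransversalU1 car2 he2 xe dB2 sB2.
  have cB2 := rank_closed_mono mm2 (subsetIl _ _) sxB2 cI.
  rewrite (theta_eq mm2 he2 dB2 n2 xe cB2) in th.
  rewrite (theta_closed tZ1 he1 dB1 n1 xe) in th.
  have sxB1 := subtransversalU1 car1 he1 xe dB1 sB1.
  have nx : x \notin B1 by rewrite (disjointFr dB1 xe).
  have rx1 : rank Z1 (x |: B1) = #|x |: B1|.
    have := rankU1_le mm1 sxB1; have := rank_mono mm1 (subsetUr [set x] B1) sxB1.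
    by move: th; rewrite cardsU1 nx r1; clear; lia.
  have := rank_trace_le mm1 sxB1 rx1 sx1.
  by move: E l1; rewrite -setUIr cardsU1 inE (negbTE nx) /=; clear; lia.
(* For the lower bound: x is non-singular, hence lies in a basis D of [x |: (A :&: U1)]. B1 is built
   around [D :\ x], one element short of the rank, so that it does not span x. *)
have rx : rank Z1 [set x] = #|[set x]|.
  by rewrite cards1 (nonsingular_rank mm1 he1 ns1 xe).
have [D [xD DA rD ->]] := basis_between mm1 (subsetUl [set x] (A :&: U1)) sx1 rx.
rewrite sub1set in xD.
have sD := sub_subtransversal DA sx1.
have DA1 : D :\ x \subset A :&: U1.
  apply/subsetP => y; rewrite !inE => /andP[yx yD].
  by move: (subsetP DA y yD); rewrite !inE (negbTE yx).
have rD1 : rank Z1 (x |: (D :\ x)) = #|D :\ x|.+1.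
  by rewrite setD1K // rD (cardsD1 x) xD.
have [B1 [n1 dB1 DB1 r1 th1]] := indep_near_extend_avoiding tZ1 he1 xe
  (sub_subtransversal (subsetDl D [set x]) sD) (disjointWr DA1 d1) rD1.
have [C [CA rC E2]] := basis_exists mm2 sA2; rewrite E2.
have [B2 [n2 dB2 CB2 r2]] := indep_near_extend tZ2 he2
  (sub_subtransversal CA sA2) (disjointWr CA d2) rC.
have sB2 : subtransversal Z2 B2 by case/andP: n2.
(* A basis of the second trace still spans x. This forces the [theta] of B2 to be x, which B1
   avoids. *)
have cC : rank Z2 (x |: C) = rank Z2 C.
  have sxC := sub_subtransversal (setUS [set x] CA) sx2.
  apply: (rankU1_eq mm2 sxC); rewrite -E2 -cx.
  by apply: rank_mono; rewrite ?setUS.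
have := @rank_two_sum_ge A B1 B2 sA n1 dB1 r1 n2 dB2 r2.
rewrite (theta_eq mm2 he2 dB2 n2 xe
  (rank_closed_mono mm2 CB2 (subtransversalU1 car2 he2 xe dB2 sB2) cC)).
move=> /(_ th1).
have : #|D :\ x| <= #|B1 :&: (A :&: U1)| by apply: subset_leq_card; rewrite subsetI DB1.
have : #|C| <= #|B2 :&: (A :&: U2)| by apply: subset_leq_card; rewrite subsetI CB2.
by rewrite rD (cardsD1 x D) xD rC; clear; lia.
Qed.

(** B1 can be chosen freely around a basis of the first trace. Whatever its [theta] x is, a basis of
    the second trace does not span x, so it extends to a B2 with another [theta], and no unit is
    lost. *)
Lemma rank_two_sum_open A : subtransversal W A ->
  (forall x, x \in e -> rank Z2 (x |: (A :&: U2)) != rank Z2 (A :&: U2)) ->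
  rank W A = rank Z1 (A :&: U1) + rank Z2 (A :&: U2).
Proof.
move=> sW op; have sA : A \subset (U1 :|: U2) :\: e by case/andP: sW.
have sA1 := two_sum_sub1 sW; have sA2 := two_sum_sub2 sW.
have d1 := two_sum_disjoint U1 sW; have d2 := two_sum_disjoint U2 sW.
apply/eqP; rewrite eqn_leq; apply/andP; split.
  apply: rank_two_sum_le => // B1 B2 n1 dB1 r1 n2 dB2 r2 th.
  by apply: leq_add; apply: rank_trace_le => //; [case/andP: n1|case/andP: n2].
have [C1 [CA1 rC1 ->]] := basis_exists mm1 sA1.
have [B1 [n1 dB1 CB1 r1]] := indep_near_extend tZ1 he1
  (sub_subtransversal CA1 sA1) (disjointWr CA1 d1) rC1.
have [x [xe th1 _]] := theta_exists tZ1 he1 dB1 n1.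
have [C2 [CA2 rC2 E2]] := basis_exists mm2 sA2; rewrite E2.
have sC2 := sub_subtransversal CA2 sA2.
have dC2 := disjointWr CA2 d2.
have sx2 := subtransversalU1 car2 he2 xe d2 sA2.
have [|B2 [n2 dB2 CB2 r2 th2]] := indep_near_extend_avoiding tZ2 he2 xe sC2 dC2.
  have sxC := subtransversalU1 car2 he2 xe dC2 sC2.
  have := rankU1_le mm2 sxC; have := rank_mono mm2 (subsetUr [set x] C2) sxC.
  have := op x xe; have := rank_closed_mono mm2 CA2 sx2.
  by move: E2 rC2; clear; lia.
have := @rank_two_sum_ge A B1 B2 sA n1 dB1 r1 n2 dB2 r2.
rewrite th1 eq_sym => /(_ th2).
have : #|C1| <= #|B1 :&: (A :&: U1)| by apply: subset_leq_card; rewrite subsetI CB1.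
have : #|C2| <= #|B2 :&: (A :&: U2)| by apply: subset_leq_card; rewrite subsetI CB2.
by rewrite rC1 rC2; clear; lia.
Qed.

End TwoSumRank.

(** * Two-sums are tight *)

Section Submodularity.
Variables (T : finType) (Z : triple T).
Hypothesis mmZ : multimatroid Z.
Implicit Types (A B : {set T}) (x : T).

Lemma rankU1_submod x A B : subtransversal Z (x |: (A :|: B)) ->
  rank Z (x |: (A :|: B)) + rank Z (x |: (A :&: B))
    <= rank Z (x |: A) + rank Z (x |: B).
Proof.
move=> sAB; have := @rank_submod T Z mmZ (x |: A) (x |: B).
by rewrite -setUUr -setUIr; apply.
Qed.

(** For comparing opposite branches of a minimum, A being measured without x and B with it. Since x
    is not in A, the intersection of A with [x |: B] is that of A with B. *)
Lemma rankU1_submod_mixed x A B : x \notin A -> subtransversal Z (x |: (A :|: B)) ->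
  rank Z (x |: (A :|: B)) + rank Z (A :&: B) <= rank Z A + rank Z (x |: B).
Proof.
move=> nx sAB; have := @rank_submod T Z mmZ A (x |: B).
rewrite setUCA setIUr; suff -> : A :&: [set x] = set0 by rewrite set0U; apply.
by apply/eqP; rewrite setI_eq0 disjoint_sym disjoints1.
Qed.

End Submodularity.

(** * Exchanging the summands *)

Section TwoSumSym.
Variables (T : finType) (Z1 Z2 : triple T) (e : {set T}).

Lemma align_sym : align Z1 Z2 e -> align Z2 Z1 e.
Proof. by case=> E *; split; rewrite // setIC. Qed.

(** The rank functions of the two triples agree pointwise, which does not identify the triples
    themselves; hence each derived notion is transported separately. *)
Lemma ground_two_sum_sym : ground (two_sum e Z1 Z2) = ground (two_sum e Z2 Z1).
Proof. by rewrite /= setUC. Qed.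

Lemma skews_two_sum_sym : skews (two_sum e Z1 Z2) = skews (two_sum e Z2 Z1).
Proof. by rewrite /= setUC. Qed.

Lemma rank_two_sum_sym A : rank (two_sum e Z1 Z2) A = rank (two_sum e Z2 Z1) A.
Proof.
rewrite /= (setUC (ground Z1)) (setUC (skews Z1)).
apply: eq_bigl => B; congr (_ && _); rewrite /two_sum_basis /=.
rewrite [theta Z2 _ == _]eq_sym.
by case: (near_transversal Z1 _); case: (independent Z1 _); rewrite /= ?andbF.
Qed.

Lemma subtransversal_two_sum_sym A :
  subtransversal (two_sum e Z1 Z2) A = subtransversal (two_sum e Z2 Z1) A.
Proof. by rewrite /subtransversal ground_two_sum_sym skews_two_sum_sym. Qed.

Lemma near_transversal_two_sum_sym A :
  near_transversal (two_sum e Z1 Z2) A = near_transversal (two_sum e Z2 Z1) A.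
Proof.
by rewrite /near_transversal subtransversal_two_sum_sym skews_two_sum_sym.
Qed.

Lemma theta_spec_two_sum_sym A u :
  theta_spec (two_sum e Z1 Z2) A u = theta_spec (two_sum e Z2 Z1) A u.
Proof. by rewrite /theta_spec skews_two_sum_sym !rank_two_sum_sym. Qed.

End TwoSumSym.

(** * Skew classes of the first summand *)

Section TwoSumClass.
Variables (T : finType) (Z1 Z2 : triple T) (e : {set T}).
Hypotheses (tZ1 : tight Z1) (tZ2 : tight Z2) (al : align Z1 Z2 e).
Implicit Types (A B C S f : {set T}) (u v x : T).

Local Notation W := (two_sum e Z1 Z2).
Local Notation U1 := (ground Z1).
Local Notation U2 := (ground Z2).

Let mm1 : multimatroid Z1. Proof. by case: tZ1. Qed.
Let mm2 : multimatroid Z2. Proof. by case: tZ2. Qed.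
Let car1 : is_carrier Z1. Proof. by case: mm1. Qed.
Let car2 : is_carrier Z2. Proof. by case: mm2. Qed.
Let carW : is_carrier W. Proof. exact: two_sum_carrier. Qed.
Let he1 : e \in skews Z1. Proof. by case: al. Qed.
Let he2 : e \in skews Z2. Proof. by case: al. Qed.

Lemma traceU1_in (V : {set T}) u S : u \in V -> (u |: S) :&: V = u |: (S :&: V).
Proof. by move=> uV; rewrite setIUl (setIidPl _) // sub1set. Qed.

Lemma traceU1_out (V : {set T}) u S : u \notin V -> (u |: S) :&: V = S :&: V.
Proof.
move=> uV; apply/setP => x; rewrite !inE; case: eqP => [->|] //=.
by rewrite (negbTE uV) andbF.
Qed.

Lemma class_two_sum f : f \in skews Z1 -> f != e -> f \in skews W.
Proof. by move=> hf nf; rewrite !inE hf nf. Qed.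

(** The class f avoids the second ground set, so S, [u |: S] and [v |: S] have the same second trace
    and fall into the same case of the rank formula. What remains is (R2) in Z1, at
    [x |: (S :&: U1)] or at [S :&: U1]. *)
Lemma two_sum_R2_class S f u v : subtransversal W S -> f \in skews Z1 -> f != e ->
  [disjoint f & S] -> u \in f -> v \in f -> u != v ->
  2 * rank W S + 1 <= rank W (u |: S) + rank W (v |: S).
Proof.
move=> sS hf nf df uf vf uv.
have fW := class_two_sum hf nf.
have suS := subtransversalU1 carW fW uf df sS.
have svS := subtransversalU1 carW fW vf df sS.
have in1 w : w \in f -> w \in U1 by apply: (subsetP (class_sub car1 hf)).
have out2 w : w \in f -> w \notin U2.
  by move=> wf; rewrite (disjointFr (class1_disjoint tZ1 al hf nf) wf).
have s1 := two_sum_sub1 tZ1 tZ2 sS.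
have d1 := two_sum_disjoint U1 sS.
have df1 : [disjoint f & S :&: U1] by apply: disjointWr df; apply: subsetIl.
have [_ _ R2] := mm1.
have [/exists_inP[x xe /eqP cx]|] :=
  boolP [exists x in e, rank Z2 (x |: (S :&: U2)) == rank Z2 (S :&: U2)].
  have F A : subtransversal W A -> A :&: U2 = S :&: U2 ->
      (rank W A).+1 = rank Z1 (x |: (A :&: U1)) + rank Z2 (S :&: U2).
    move=> sA E; rewrite -E; apply: rank_two_sum_closed => //.
    by rewrite E.
  have := F _ suS (traceU1_out S (out2 u uf)).
  have := F _ svS (traceU1_out S (out2 v vf)).
  have := F _ sS erefl.
  rewrite !traceU1_in ?in1 // !(setUCA [set x]).
  have dfx : [disjoint f & x |: (S :&: U1)].
    by apply: (class_disjointU1 car1 hf he1) => //; apply: disjointWr df; apply: subsetIl.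
  have := R2 _ f u v (subtransversalU1 car1 he1 xe d1 s1) hf dfx uf vf uv.
  by clear; lia.
move=> op.
have F A : subtransversal W A -> A :&: U2 = S :&: U2 ->
    rank W A = rank Z1 (A :&: U1) + rank Z2 (S :&: U2).
  move=> sA E; rewrite -E; apply: rank_two_sum_open => // x xe; rewrite E.
  by apply: contraNneq op => cx; apply/exists_inP; exists x; rewrite ?cx.
rewrite (F _ sS erefl) (F _ suS (traceU1_out S (out2 u uf))).
rewrite (F _ svS (traceU1_out S (out2 v vf))) !traceU1_in ?in1 //.
have := R2 _ f u v s1 hf df1 uf vf uv.
by clear; lia.
Qed.

(** The only class missed by S lies in Z1, so the second trace is a near-transversal of Z2 and spans
    some x in e. Completed by x, the first trace becomes a near-transversal of Z1 missing f, and the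
    element of f it spans is the one sought. *)
Lemma two_sum_theta_class S f : near_transversal W S -> f \in skews Z1 -> f != e ->
  [disjoint f & S] -> exists u, theta_spec W S u.
Proof.
move=> nS hf nf df; have fW := class_two_sum hf nf.
have sS : subtransversal W S by case/andP: nS.
have s1 := two_sum_sub1 tZ1 tZ2 sS; have s2 := two_sum_sub2 tZ1 tZ2 sS.
have d1 := two_sum_disjoint U1 sS; have d2 := two_sum_disjoint U2 sS.
have mS g : g \in missing W S -> g = f.
  rewrite inE => /andP[hg dg]; move: nS; rewrite (near_transversalP carW fW df).
  by move=> /andP[_ /forall_inP/(_ g hg)]; rewrite dg /= => /eqP.
have out2 w : w \in f -> w \notin U2.
  by move=> wf; rewrite (disjointFr (class1_disjoint tZ1 al hf nf) wf).
have n2 : near_transversal Z2 (S :&: U2).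
  rewrite (near_transversalP car2 he2 d2) s2; apply/forall_inP => g hg.
  apply/implyP => dg; apply/contraT => ng.
  have E : g = f by apply: mS; rewrite missing_two_sum // !inE ng hg dg orbT.
  have [u uf] := class_inhabited car1 hf; have := out2 u uf.
  by rewrite -E in uf; rewrite (subsetP (class_sub car2 hg)).
have [x [xe _ cx]] := theta_exists tZ2 he2 d2 n2.
have dfx : [disjoint f & x |: (S :&: U1)].
  by apply: (class_disjointU1 car1 hf he1) => //; apply: disjointWr df; apply: subsetIl.
have n1 : near_transversal Z1 (x |: (S :&: U1)).
  rewrite (near_transversalP car1 hf dfx) (subtransversalU1 car1 he1 xe d1 s1) /=.
  apply/forall_inP => g hg; apply/implyP => dg; apply/eqP/mS.
  rewrite missing_two_sum // !inE hg (disjointWr (subsetUr _ _) dg) /= andbT.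
  by apply: contraTneq dg => ->; apply/negP => /disjointFr/(_ xe); rewrite setU11.
have [w [wf _ cw]] := theta_exists tZ1 hf dfx n1.
exists w; apply/andP; split; first by apply/exists_inP; exists f; rewrite ?wf.
have sw := subtransversalU1 carW fW wf df sS.
have tw := traceU1_out S (out2 w wf).
have := rank_two_sum_closed tZ1 tZ2 al sw xe; rewrite tw => /(_ cx).
have := rank_two_sum_closed tZ1 tZ2 al sS xe cx.
rewrite traceU1_in ?(subsetP (class_sub car1 hf)) // setUCA cw.
by move=> <- [] /eqP.
Qed.

(** The second trace of [[set u]] is empty and spans nothing in e, because e is non-singular in Z2;
    so the rank of u is the same as in Z1. *)
Lemma two_sum_nonsingular f : f \in skews Z1 -> f != e -> ~~ singular_class Z1 f ->
  ~~ singular_class W f.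
Proof.
move=> hf nf ns; apply/negP => /exists_inP[u uf /eqP su].
have fW := class_two_sum hf nf.
have u1 : u \in U1 by apply: (subsetP (class_sub car1 hf)).
have u2 : u \notin U2 by rewrite (disjointFr (class1_disjoint tZ1 al hf nf) uf).
have sW : subtransversal W [set u].
  by apply: subtransversal1 => //; apply: (subsetP (class_sub carW fW)).
have t1 : [set u] :&: U1 = [set u] by apply/setIidPl; rewrite sub1set.
have t2 : [set u] :&: U2 = set0.
  by apply/eqP; rewrite setI_eq0 disjoints1.
have r0 : rank Z2 set0 = 0.
  by apply/eqP; rewrite -leqn0 -(cards0 T) rank_le_card // subtransversal0.
have := rank_two_sum_open tZ1 tZ2 al sW; rewrite t1 t2 r0 su.
rewrite (nonsingular_rank mm1 hf ns uf) => H.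
have : forall x, x \in e -> rank Z2 (x |: set0) != 0.
  move=> x xe; rewrite setU0 (nonsingular_rank mm2 he2 _ xe) //.
  by case: al.
by move=> /H.
Qed.

(** Keeps the remaining summands of a star product aligned with the part already built: Z3 meets no
    element brought in by Z2, and removing e takes nothing from the distinct class f. *)
Lemma two_sum_align Z3 f : align Z1 Z3 f -> f != e -> [disjoint U2 & ground Z3] ->
  align W Z3 f.
Proof.
case=> E hf ns hf3 ns3 nf d; split; rewrite ?two_sum_nonsingular ?class_two_sum //.
rewrite -E; apply/setP => x; rewrite !inE; case x3: (x \in ground Z3); rewrite ?andbF //.
rewrite !andbT (disjointFl d x3) orbF; case x1: (x \in U1); rewrite ?andbF ?andbT //.
apply/negP => xe; move/negP: nf; apply; apply/eqP.
by apply: (class_uniq car1 hf he1 _ xe); rewrite -E inE x1.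
Qed.

End TwoSumClass.

Section TwoSumTight.
Variables (T : finType) (Z1 Z2 : triple T) (e : {set T}).
Hypotheses (tZ1 : tight Z1) (tZ2 : tight Z2) (al : align Z1 Z2 e).
Implicit Types (A B C S f : {set T}) (u v x : T).

Local Notation W := (two_sum e Z1 Z2).
Local Notation U1 := (ground Z1).
Local Notation U2 := (ground Z2).

Let mm1 : multimatroid Z1. Proof. by case: tZ1. Qed.
Let mm2 : multimatroid Z2. Proof. by case: tZ2. Qed.
Let car1 : is_carrier Z1. Proof. by case: mm1. Qed.
Let car2 : is_carrier Z2. Proof. by case: mm2. Qed.
Let carW : is_carrier W. Proof. exact: two_sum_carrier. Qed.
Let he1 : e \in skews Z1. Proof. by case: al. Qed.
Let he2 : e \in skews Z2. Proof. by case: al. Qed.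

(* This makes the rank submodular: both functions under the minimum are
   submodular in A, and so is the mixed comparison because x is not in A. *)
Lemma rank_two_sum_min S x A : transversal W S -> x \in e ->
  rank Z2 (x |: (S :&: U2)) = rank Z2 (S :&: U2) -> A \subset S ->
  (rank W A).+1 = minn (rank Z1 (A :&: U1) + rank Z2 (A :&: U2)).+1
                       (rank Z1 (x |: (A :&: U1)) + rank Z2 (x |: (A :&: U2))).
Proof.
move=> tS xe cx sAS.
have sS : subtransversal W S by case/andP: tS.
have sA := sub_subtransversal sAS sS.
have sA1 := two_sum_sub1 tZ1 tZ2 sA; have sA2 := two_sum_sub2 tZ1 tZ2 sA.
have sS2 := two_sum_sub2 tZ1 tZ2 sS.
have d1 := two_sum_disjoint U1 sA; have d2 := two_sum_disjoint U2 sA.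
have dS2 := two_sum_disjoint U2 sS.
have sx1 := subtransversalU1 car1 he1 xe d1 sA1.
have sx2 := subtransversalU1 car2 he2 xe d2 sA2.
have l1 := rankU1_le mm1 sx1; have l1' := rank_mono mm1 (subsetUr [set x] _) sx1.
have l2 := rankU1_le mm2 sx2; have l2' := rank_mono mm2 (subsetUr [set x] _) sx2.
have [c2|nc2] := eqVneq (rank Z2 (x |: (A :&: U2))) (rank Z2 (A :&: U2)).
  have := rank_two_sum_closed tZ1 tZ2 al sA xe c2.
  by move: l1 l1' c2; clear; lia.
rewrite (rank_two_sum_open tZ1 tZ2 al sA); first by move: l1' l2 l2' nc2; clear; lia.
move=> y ye; apply: contraNneq nc2 => cy.
suff <- : y = x by rewrite cy.
apply: (closed_uniq mm2 he2 dS2 sS2 ye xe _ cx).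
apply: (rank_closed_mono mm2 _ _ cy); first exact: setSI.
exact: (subtransversalU1 car2 he2).
Qed.

Lemma two_sum_R1 : axiom_R1 W.
Proof.
move=> S tS; split.
- move=> A _; apply/bigmax_leqP => B _.
  by apply: subset_leq_card; apply: subsetIr.
- move=> A B sAB _; apply/bigmax_leqP => C hC.
  apply: leq_trans (leq_bigmax_cond (F := fun C => #|C :&: B|) C hC).
  by apply: subset_leq_card; apply: setIS.
move=> A B sA sB.
have sS : subtransversal W S by case/andP: tS.
have n2 := two_sum_near2 tZ1 tZ2 al tS.
(* Taking x from the whole transversal makes the same minimum measure all four sets. *)
have [x [xe _ cx]] := theta_exists tZ2 he2 (two_sum_disjoint _ sS) n2.
have F := rank_two_sum_min tS xe cx.
have sAB : A :|: B \subset S by rewrite subUset sA.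
have sIAB : A :&: B \subset S by rewrite subIset ?sA.
have := F _ sA; have := F _ sB; have := F _ sAB; have := F _ sIAB.
rewrite !setIUl !(setIIl A B).
(* When the minima at A and at B are attained on different sides, the union is bounded by the term
   with x and the intersection by the term without; the last two inequalities serve this case. *)
have key Z : multimatroid Z -> e \in skews Z ->
    subtransversal Z ((A :|: B) :&: ground Z) ->
  let a := A :&: ground Z in let b := B :&: ground Z in
  [/\ rank Z (a :|: b) + rank Z (a :&: b) <= rank Z a + rank Z b,
      rank Z (x |: (a :|: b)) + rank Z (x |: (a :&: b))
        <= rank Z (x |: a) + rank Z (x |: b),
      rank Z (x |: (a :|: b)) + rank Z (a :&: b) <= rank Z a + rank Z (x |: b) &
      rank Z (x |: (a :|: b)) + rank Z (a :&: b) <= rank Z (x |: a) + rank Z b].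
  move=> mmZ he; rewrite setIUl => stAB a b.
  have nx C : C \subset S -> x \notin C :&: ground Z.
    move=> sC; have dC := two_sum_disjoint (ground Z) (sub_subtransversal sC sS).
    by rewrite (disjointFr dC xe).
  have dab : [disjoint e & a :|: b].
    rewrite -setIUl; apply: two_sum_disjoint (sub_subtransversal sAB sS).
  have stx : subtransversal Z (x |: (a :|: b)).
    by apply: (subtransversalU1 _ he xe dab) => //; case: mmZ.
  split.
  - exact: rank_submod.
  - exact: rankU1_submod.
  - by apply: rankU1_submod_mixed => //; apply: nx.
  rewrite (setUC a) (setIC a) [X in _ <= X]addnC.
  by apply: rankU1_submod_mixed; rewrite ?(setUC b) //; apply: nx.
have [] := key Z1 mm1 he1 (two_sum_sub1 tZ1 tZ2 (sub_subtransversal sAB sS)).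
have [] := key Z2 mm2 he2 (two_sum_sub2 tZ1 tZ2 (sub_subtransversal sAB sS)).
by rewrite /=; clear; lia.
Qed.

End TwoSumTight.

Lemma two_sum_tight (T : finType) (Z1 Z2 : triple T) (e : {set T}) :
  tight Z1 -> tight Z2 -> align Z1 Z2 e -> tight (two_sum e Z1 Z2).
Proof.
move=> tZ1 tZ2 al; have al' := align_sym al.
have carW := two_sum_carrier tZ1 tZ2 al.
split.
- split=> //; first exact: two_sum_R1.
  move=> S f u v sS; rewrite !inE => /andP[nf /orP[] hf] df uf vf uv.
    exact: (two_sum_R2_class tZ1 tZ2 al sS hf nf df uf vf uv).
  rewrite subtransversal_two_sum_sym in sS; rewrite !(rank_two_sum_sym Z1).
  exact: (two_sum_R2_class tZ2 tZ1 al' sS hf nf df uf vf uv).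
- move=> f; rewrite !inE => /andP[_ /orP[]].
    by case: tZ1 => _ nd _; apply: nd.
  by case: tZ2 => _ nd _; apply: nd.
move=> S nS; have [f] := near_missing carW nS.
rewrite !inE => /andP[nf /orP[] hf] df.
  exact: (two_sum_theta_class tZ1 tZ2 al nS hf nf df).
rewrite near_transversal_two_sum_sym in nS.
have [u hu] := two_sum_theta_class tZ2 tZ1 al' nS hf nf df.
by exists u; rewrite theta_spec_two_sum_sym.
Qed.

Local Open Scope ring_scope.

(** * Transition sums of two-sums, minors and star products *)

Section WeightedSums.
Variables (T : finType) (R : comNzRingType) (t : R).
Implicit Types (Z : triple T) (A B S e f : {set T}) (u v x : T) (z : T -> R).

(** The transition polynomial evaluated at t and z; for the indeterminates themselves it is
    convertible to [Q]. A substitution thus becomes a change of weights. *)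
Definition wsum z Z : R :=
  \sum_(S | transversal Z S) t ^+ nullity Z S * \prod_(u in S) z u.

Definition avoiding Z e S := near_transversal Z S && [disjoint e & S].

(** For indeterminate weights and Z the summand attached at e, this is the solution y_u of the
    linear system. *)
Definition wbranch z Z e u : R :=
  \sum_(S | avoiding Z e S && (theta Z S == Some u))
    t ^+ nullity Z S * \prod_(v in S) z v.

Lemma eq_wsum z z' Z : {in ground Z, z =1 z'} -> wsum z Z = wsum z' Z.
Proof.
move=> E; apply: eq_bigr => S /andP[/andP[/subsetP sS _] _]; congr (_ * _).
by apply: eq_bigr => u uS; rewrite E ?sS.
Qed.

Lemma avoiding_sub Z e S u : avoiding Z e S -> u \in S -> u \in ground Z :\: e.
Proof.
case/andP=> /andP[/andP[/subsetP sS _] _] d uS.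
by rewrite inE sS // (disjointFl d uS).
Qed.

Lemma eq_wbranch z z' Z e u : {in ground Z :\: e, z =1 z'} ->
  wbranch z Z e u = wbranch z' Z e u.
Proof.
move=> E; apply: eq_bigr => S /andP[aS _]; congr (_ * _).
by apply: eq_bigr => v vS; rewrite E ?(avoiding_sub aS).
Qed.

Lemma sum_theta Z e (G : {set T} -> R) : tight Z -> e \in skews Z ->
  \sum_(S | avoiding Z e S) G S =
  \sum_(u in e) \sum_(S | avoiding Z e S && (theta Z S == Some u)) G S.
Proof.
move=> tZ he; rewrite (exchange_big_dep (avoiding Z e)) /=; last first.
  by move=> u S _ /andP[].
apply: eq_bigr => S aS; have /andP[nS dS] := aS.
have [x [xe tx _]] := theta_exists tZ he dS nS.
rewrite (big_pred1 x) // => u; rewrite aS tx /=.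
by rewrite (inj_eq Some_inj) eq_sym; case: eqP => [->|]; rewrite ?xe ?andbF.
Qed.

Lemma sum_transversal Z e (G : {set T} -> R) : is_carrier Z -> e \in skews Z ->
  \sum_(B | transversal Z B) G B =
  \sum_(u in e) \sum_(S | avoiding Z e S) G (u |: S).
Proof.
move=> carZ he.
transitivity (\sum_(u in e) \sum_(B | transversal Z B && (u \in B)) G B).
  rewrite (exchange_big_dep (transversal Z)) /=; last by move=> u B _ /andP[].
  apply: eq_bigr => B tB; have [x [xe xB _]] := transversal_meets carZ he tB.
  rewrite (big_pred1 x) // => u; rewrite tB /=; apply/andP/eqP => [[ue uB]|-> //].
  by have /andP[/(subtransversalP Z B)[_ h] _] := tB; apply: (h e).
apply: eq_bigr => u ue.
rewrite (reindex_onto (fun S => u |: S) (fun B => B :\ u)) /=; last first.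
  by move=> B /andP[_ uB]; rewrite setD1K.
apply: eq_bigl => S; rewrite setU11 andbT; apply/andP/andP => [[tB /eqP E]|[nS dS]].
  have [x [xe xB EB]] := transversal_meets carZ he tB.
  have Exu : x = u.
    have /andP[/(subtransversalP Z _)[_ h] _] := tB.
    by apply: (h e); rewrite // setU11.
  have ES : S = (u |: S) :\: e by rewrite EB Exu.
  split; rewrite ES; first exact: transversal_near.
  exact: disjoint_setD.
split; first exact: near_transversal_add he ue dS nS.
by rewrite setU1K // (disjointFr dS ue).
Qed.

Lemma sum_two_sum Z1 Z2 e (G : {set T} -> R) :
  tight Z1 -> tight Z2 -> align Z1 Z2 e ->
  \sum_(B | transversal (two_sum e Z1 Z2) B) G B =
  \sum_(S1 | avoiding Z1 e S1) \sum_(S2 | avoiding Z2 e S2) G (S1 :|: S2).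
Proof.
move=> tZ1 tZ2 al; rewrite pair_big /=.
rewrite (reindex_onto (fun p : {set T} * {set T} => p.1 :|: p.2)
  (fun B => (B :&: ground Z1, B :&: ground Z2))) /=; last first.
  move=> B /andP[/andP[/= sB _] _]; rewrite -setIUr; apply/setIidPl.
  exact: subset_trans sB (subsetDl _ _).
apply: eq_bigl => -[S1 S2] /=; apply/andP/andP => [[tB /eqP[E1 E2]]|].
  have sB : subtransversal (two_sum e Z1 Z2) (S1 :|: S2) by case/andP: tB.
  have := two_sum_near1 tZ1 tZ2 al tB; have := two_sum_near2 tZ1 tZ2 al tB.
  have := two_sum_disjoint (ground Z1) sB; have := two_sum_disjoint (ground Z2) sB.
  by rewrite E1 E2 /avoiding => -> -> -> ->.
case=> /andP[n1 d1] /andP[n2 d2]; split; first exact: union_transversal.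
have /andP[/andP[g1 _] _] := n1; have /andP[/andP[g2 _] _] := n2.
by rewrite (union_trace1 al g1 g2 d2) (union_trace2 al g1 g2 d1).
Qed.

(** Both the size and the rank of the union are one less than the corresponding sums for [x |: S1]
    and S2, and the two defects cancel. *)
Lemma nullity_two_sum Z1 Z2 e S1 S2 x : tight Z1 -> tight Z2 -> align Z1 Z2 e ->
  avoiding Z1 e S1 -> avoiding Z2 e S2 -> x \in e -> theta Z2 S2 = Some x ->
  nullity (two_sum e Z1 Z2) (S1 :|: S2) =
  (nullity Z1 (x |: S1) + nullity Z2 S2)%N.
Proof.
move=> tZ1 tZ2 al /andP[n1 d1] /andP[n2 d2] xe th.
have [[mm1 _ _] [mm2 _ _]] := (tZ1, tZ2).
have [car1 _ _] := mm1; have [_ he1 _ he2 _] := al.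
have s1 : subtransversal Z1 S1 by case/andP: n1.
have s2 : subtransversal Z2 S2 by case/andP: n2.
have /andP[g1 _] := s1; have /andP[g2 _] := s2.
have tB := union_transversal tZ1 tZ2 al n1 d1 n2 d2.
have /andP[sB _] := tB; have /andP[gB _] := sB.
have E1 := union_trace1 al g1 g2 d2; have E2 := union_trace2 al g1 g2 d1.
have := two_sum_card al (S1 :|: S2) gB; rewrite E1 E2 !setIid => cU.
have /eqP := th; rewrite (theta_closed tZ2 he2 d2 n2 xe) => /eqP cx.
have := rank_two_sum_closed tZ1 tZ2 al sB xe; rewrite E1 E2 => /(_ cx).
have := rank_le_card mm1 (subtransversalU1 car1 he1 xe d1 s1).
have := rank_le_card mm2 s2.
rewrite /nullity cU cardsU1 (disjointFr d1 xe) /=; clear; lia.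
Qed.

Lemma wsum_two_sum z Z1 Z2 e : tight Z1 -> tight Z2 -> align Z1 Z2 e ->
  wsum z (two_sum e Z1 Z2) =
  wsum (fun u => if u \in e then wbranch z Z2 e u else z u) Z1.
Proof.
move=> tZ1 tZ2 al; have [[[car1 _ _] _ _] [_ he1 _ he2 _]] := (tZ1, al).
(* For a fixed S1, both sides become sums over x in e: on the left x is the [theta] of S2, on the
   right it is the element completing S1 to a transversal of Z1. *)
rewrite /wsum sum_two_sum // (sum_transversal _ car1 he1) [RHS]exchange_big /=.
apply: eq_bigr => S1 a1; have /andP[n1 d1] := a1.
rewrite (sum_theta _ tZ2 he2); apply: eq_bigr => x xe.
rewrite big_setU1 ?(disjointFr d1 xe) //= xe mulrCA !mulr_suml.
apply: eq_bigr => S2 /andP[a2 /eqP th].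
rewrite (nullity_two_sum tZ1 tZ2 al a1 a2 xe th) exprD.
have -> : \prod_(u in S1) (if u \in e then wbranch z Z2 e u else z u) =
          \prod_(u in S1) z u.
  by apply: eq_bigr => u u1; rewrite (disjointFl d1 u1).
have d12 : [disjoint S1 & S2].
  rewrite -setI_eq0; apply/eqP/setP => y; rewrite !inE.
  apply/negP => /andP[/(avoiding_sub a1) h1 /(avoiding_sub a2)].
  move: h1; rewrite !inE (align_mem al).
  by case: (y \in ground Z1); case: (y \in ground Z2).
have -> : \prod_(u in S1 :|: S2) z u = (\prod_(u in S1) z u) * \prod_(u in S2) z u.
  by rewrite -bigU //=; apply: eq_bigl => y; rewrite !inE.
by ring.
Qed.

Lemma wsum_minor z Z e u : tight Z -> e \in skews Z -> ~~ singular_class Z e ->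
  u \in e ->
  wsum z (minor Z u) =
  t * wbranch z Z e u + \sum_(v in e | v != u) wbranch z Z e v.
Proof.
move=> tZ he ns ue; have [mmZ _ _] := tZ; have [carZ _ _] := mmZ.
have pb : pblock (skews Z) u = e.
  by apply: def_pblock => //; apply: partition_trivIset carZ.
have TE S : transversal (minor Z u) S = avoiding Z e S.
  rewrite /avoiding /transversal /near_transversal /subtransversal /= pb.
  rewrite subsetD (disjoint_sym S) [#|skews Z|](cardsD1 e) he add1n eqSS.
  case: (boolP [disjoint e & S]) => dS; rewrite ?andbF ?andbT //.
  congr (_ && _ && _); apply/forall_inP/forall_inP => h f.
    have [->|nf hf] := eqVneq f e; last by apply: h; rewrite !inE nf.
    by move=> _; move: dS; rewrite -setI_eq0 setIC => /eqP->; rewrite cards0.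
  by rewrite !inE => /andP[_]; apply: h.
(* Since u is non-singular, the minor gives S the rank of [u |: S] minus one. This is the rank of S
   in Z, except when S spans u, where it is one less. *)
have NE v S : v \in e -> avoiding Z e S -> theta Z S == Some v ->
    nullity (minor Z u) S = ((v == u) + nullity Z S)%N.
  move=> ve /andP[nS dS] th; have sS : subtransversal Z S by case/andP: nS.
  have su := subtransversalU1 carZ he ue dS sS.
  have := rankU1_le mmZ su; have := rank_mono mmZ (subsetUr [set u] S) su.
  have := rank_le_card mmZ sS; have := theta_closed tZ he dS nS ue.
  rewrite (eqP th) (inj_eq Some_inj) /nullity /=.
  have := rank_mono mmZ (subsetUl [set u] S) su.
  rewrite (nonsingular_rank mmZ he ns ue).
  by case: (v == u) => /= + /esym; clear; lia.
rewrite /wsum (eq_bigl _ _ TE) (sum_theta _ tZ he) (bigD1 u) //=; congr (_ + _).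
  rewrite mulr_sumr; apply: eq_bigr => S /andP[aS th].
  by rewrite (NE u) // eqxx add1n exprS mulrA.
apply: eq_bigr => v /andP[ve nv]; apply: eq_bigr => S /andP[aS th].
by rewrite (NE v) // (negbTE nv).
Qed.

(** The centre Z varies in the induction, since it absorbs one summand at each step. The weights z'
    are final on the classes still to be summed and equal to z elsewhere on Z. *)
Lemma wsum_star_product (Ze : {set T} -> triple T) z z' (s : seq {set T}) Z :
  tight Z -> uniq s ->
  (forall e, e \in s -> tight (Ze e)) ->
  (forall e, e \in s -> align Z (Ze e) e) ->
  {in s &, forall e f, e != f -> [disjoint ground (Ze e) & ground (Ze f)]} ->
  (forall e u, e \in s -> u \in e -> z' u = wbranch z (Ze e) e u) ->
  (forall u, u \in ground Z -> (forall e, e \in s -> u \notin e) -> z' u = z u) ->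
  wsum z (star_product Z Ze s) = wsum z' Z.
Proof.
elim: s Z z' => [|e s IH] Z z' tZ /=.
  by move=> _ _ _ _ _ h; apply: eq_wsum => u uZ; rewrite h.
case/andP=> nes us tZe alZe dZe hz' hz.
have es : e \in e :: s by rewrite mem_head.
have ins f : f \in s -> f \in e :: s by move=> fs; rewrite inE fs orbT.
have tE := tZe e es; have alE := alZe e es.
have nfe f : f \in s -> f != e by move=> fs; apply: contraNneq nes => <-.
have hfZ f : f \in s -> f \in skews Z by move=> /ins/alZe[].
(* Weights for the enlarged centre: elements brought in by [Ze e] keep z, those of Z already have
   their final weight. The elements of e have left the ground set, so their value is immaterial. *)
pose z'' u := if u \in ground (Ze e) then z u else z' u.
rewrite (IH (two_sum e Z (Ze e)) z'') //.
- rewrite wsum_two_sum //; apply: eq_wsum => u uZ.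
  have [ue|nue] := boolP (u \in e).
    rewrite (hz' e) //; apply: eq_wbranch => v; rewrite inE /z'' => /andP[_ ->] //.
  rewrite /z''; suff /negbTE -> : u \notin ground (Ze e) by [].
  by move: nue; rewrite (align_mem alE) uZ.
- exact: two_sum_tight.
- by move=> f /ins; apply: tZe.
- move=> f fs; apply: two_sum_align => //; [exact: alZe (ins f fs) | exact: nfe |].
  by apply: dZe es (ins f fs) _; rewrite eq_sym nfe.
- by move=> f g fs gs; apply: dZe; apply: ins.
- move=> f u fs uf; rewrite -(hz' f u (ins f fs) uf) /z''.
  by rewrite (disjointFr (class1_disjoint tZ alE (hfZ f fs) (nfe f fs)) uf).
move=> u; rewrite !inE => /andP[nue uU] h; rewrite /z''.
case: ifP => // nu; rewrite nu orbF in uU; apply: hz => // f.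
by rewrite inE => /predU1P[->|/h].
Qed.

End WeightedSums.

(** * The linear system *)

Section PolyOn.
Variables (T : finType) (A : {set T}).
Implicit Types (p q : polring T) (u : T).

Lemma poly_onD p q : poly_on A p -> poly_on A q -> poly_on A (p + q).
Proof.
move=> hp hq m /msuppD_le; rewrite mem_cat => /orP[/hp|/hq]; exact.
Qed.

Lemma poly_onM p q : poly_on A p -> poly_on A q -> poly_on A (p * q).
Proof.
move=> hp hq m /msuppM_le/allpairsP[[m1 m2] /= [h1 h2 ->]] u uA.
by rewrite mnmDE (hp _ h1) // (hq _ h2).
Qed.

Lemma poly_on0 : poly_on A 0.
Proof. by move=> m; rewrite msupp0. Qed.

Lemma poly_on1 : poly_on A 1.
Proof. by move=> m; rewrite msupp1 inE => /eqP -> u _; rewrite mnm0E. Qed.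

Lemma poly_on_var_t : poly_on A (var_t T).
Proof.
move=> m; rewrite msuppX inE => /eqP -> u _.
by rewrite mnm1E (inj_eq enum_rank_inj).
Qed.

Lemma poly_on_var_x u : u \in A -> poly_on A (var_x u).
Proof.
move=> uA m; rewrite msuppX inE => /eqP -> v; rewrite mnm1E (inj_eq enum_rank_inj).
by rewrite (inj_eq Some_inj); case: eqP => // <-; rewrite uA.
Qed.

Lemma poly_on_sum (I : finType) (P : pred I) (F : I -> polring T) :
  (forall i, P i -> poly_on A (F i)) -> poly_on A (\sum_(i | P i) F i).
Proof. by move=> h; apply: big_ind => //; [apply: poly_on0|apply: poly_onD]. Qed.

Lemma poly_on_prod (I : finType) (P : pred I) (F : I -> polring T) :
  (forall i, P i -> poly_on A (F i)) -> poly_on A (\prod_(i | P i) F i).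
Proof. by move=> h; apply: big_ind => //; [apply: poly_on1|apply: poly_onM]. Qed.

Lemma poly_onX p n : poly_on A p -> poly_on A (p ^+ n).
Proof.
move=> hp; elim: n => [|n IH]; first exact: poly_on1.
by rewrite exprS; apply: poly_onM.
Qed.

End PolyOn.

(** With q the size of e, the matrix of the system has determinant (t - 1)^(q-1) (t - 1 + q). Both
    factors have the form t + n, and t occurs there with coefficient 1. *)
Lemma var_t_addz_neq0 (T : finType) (n : int) : var_t T + n%:~R != 0.
Proof.
apply/eqP => /(congr1 (mcoeff U_(enum_rank (None : option T)))).
rewrite mcoeffD mcoeffXU eqxx mcoeff0 raddfMz /= mcoeff1 mnm1_eq0 mul0rz addr0 => /eqP.
by rewrite oner_eq0.
Qed.

(* Adding up the equations, the difference d of two solutions satisfies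
   (t - 1) d_u = - D and (t - 1 + #|e|) D = 0, where D is the sum of the d_u. *)
Lemma system_uniq (T : finType) (R : idomainType) (t : R) (e : {set T})
    (y z : T -> R) : t - 1 != 0 -> t - 1 + #|e|%:R != 0 ->
  (forall u, u \in e -> t * z u + \sum_(v in e | v != u) z v =
                        t * y u + \sum_(v in e | v != u) y v) ->
  {in e, z =1 y}.
Proof.
move=> t1 tq h; pose d u := z u - y u; pose D := \sum_(u in e) d u.
have hd u : u \in e -> (t - 1) * d u = - D.
  move=> ue; apply/eqP; rewrite -addr_eq0 /D (bigD1 u) //= addrA mulrBl mul1r subrK.
  by rewrite /d sumrB mulrBr addrACA -opprD h // subrr.
have D0 : D = 0.
  have : (t - 1 + #|e|%:R) * D = 0.
    rewrite mulrDl {1}/D mulr_sumr (eq_bigr (fun=> - D)) // sumr_const.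
    by rewrite mulr_natl mulNrn addNr.
  by move/eqP; rewrite mulf_eq0 (negbTE tq) => /eqP.
move=> u ue; apply/eqP; rewrite -subr_eq0.
by have /eqP := hd u ue; rewrite D0 oppr0 mulf_eq0 (negbTE t1).
Qed.

Lemma subst_x_Q (T : finType) (Z : triple T) (y : T -> polring T) :
  subst_x y (Q Z) = wsum (var_t T) y Z.
Proof.
have tE : subst_x y (var_t T) = var_t T.
  by rewrite /subst_x comp_mpolyXU -tnth_nth tnth_mktuple enum_rankK.
have xE u : subst_x y (var_x u) = y u.
  by rewrite /subst_x comp_mpolyXU -tnth_nth tnth_mktuple enum_rankK.
rewrite /subst_x in tE xE *; rewrite rmorph_sum; apply: eq_bigr => S _.
rewrite rmorphM rmorphXn rmorph_prod /= tE; congr (_ * _).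
by apply: eq_bigr => u _; apply: xE.
Qed.

Theorem theorem15 (T : finType) (Z1 : triple T) (Ze : {set T} -> triple T)
    (s : seq {set T})
    (tight_Z1 : tight Z1)
    (nonsing_Z1 : forall e, e \in skews Z1 -> ~~ singular_class Z1 e)
    (tight_Ze : forall e, e \in skews Z1 -> tight (Ze e))
    (align_Ze : forall e, e \in skews Z1 -> align Z1 (Ze e) e)
    (graphable_Z : graphable (@star_collection T Z1 Ze))
    (star_Z : star_graph (collection_graph (@star_collection T Z1 Ze)) None)
    (enum_s : perm_eq s (enum (skews Z1))) :
  exists y : T -> polring T,
    (forall e, e \in skews Z1 -> is_unique_solution (Ze e) e y) /\
    Q (star_product Z1 Ze s) = subst_x y (Q Z1).
Proof.
have [[carZ1 _ _] _ _] := tight_Z1.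
have [y yE] : exists y : T -> polring T, forall e u, e \in skews Z1 -> u \in e ->
    y u = wbranch (var_t T) (@var_x T) (Ze e) e u.
  (* The skew classes of Z1 are disjoint, so one function on T can hold the solutions of all the
     systems; [pblock] recovers the class of u. *)
  exists (fun u => wbranch (var_t T) (@var_x T) (Ze (pblock (skews Z1) u))
                           (pblock (skews Z1) u) u) => e u he ue.
  by rewrite (def_pblock _ he ue) //; apply: partition_trivIset carZ1.
have memS e : (e \in s) = (e \in skews Z1).
  by rewrite (perm_mem enum_s) mem_enum.
exists y; split=> [e he|]; last first.
  rewrite subst_x_Q; apply: (wsum_star_product tight_Z1 _).
  - by rewrite (perm_uniq enum_s) enum_uniq.
  - by move=> e; rewrite memS; apply: tight_Ze.
  - by move=> e; rewrite memS; apply: align_Ze.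
  - move=> e f; rewrite !memS => he hf nef.
    (* Two leaves of the star are not adjacent, so their ground sets are disjoint. *)
    have := star_Z (Some (exist _ e he)) (Some (exist _ f hf)).
    rewrite /collection_graph /= andbF.
    have -> /= : Some (exist _ e he) != Some (exist _ f hf).
      by apply: contraNneq nef => -[->].
    by move/negbT; rewrite negbK setI_eq0.
  - by move=> e u; rewrite memS; apply: yE.
  (* Every element of Z1 lies in a class listed in s, so no weight of Z1 keeps its indeterminate. *)
  move=> u /(class_exists carZ1)[e he ue] /(_ e).
  by rewrite memS he ue => /(_ isT).
have solE u : u \in e ->
    Q (minor (Ze e) u) = var_t T * y u + \sum_(v in e | v != u) y v.
  move=> ue; have [_ _ _ he2 ns2] := align_Ze e he.
  apply: etrans (wsum_minor (var_t T) (@var_x T) (tight_Ze e he) he2 ns2 ue) _.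
  rewrite (yE e u he ue); congr (_ + _).
  by apply: eq_bigr => v /andP[ve _]; rewrite (yE e v he ve).
split.
  split=> // u ue; rewrite (yE e) //; apply: poly_on_sum => S /andP[aS _].
  apply: poly_onM; first exact/poly_onX/poly_on_var_t.
  by apply: poly_on_prod => v vS; apply/poly_on_var_x/(avoiding_sub aS).
move=> z [_ hz]; apply: (@system_uniq _ _ (var_t T)).
- exact: (var_t_addz_neq0 T (-1)).
- by have := var_t_addz_neq0 T (#|e|%:Z - 1); rewrite intrB addrCA addrC.
by move=> u ue; rewrite -hz // solE.
Qed.
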